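(* Let $\varepsilon<1$ be any constant and let $C$ be a sufficiently large constant. Let $p=p(n)$ satisfy $Cn^{-1/4}(\ln n)^{9/4}\le p<\varepsilon$. Then with high probability \[\tau_2(G_{n,p})=(2+o(1))\,\chi(G_{n,p}).\]
   Context: For a positive integer $t$ and a graph $G$, a (proper) $t$-tone $k$-coloring of $G$ is a function $f:V(G)\to\binom{[k]}{t}$ (the $t$-element subsets of $[k]=\{1,\dots,k\}$) such that $|f(u)\cap f(v)|<d(u,v)$ for all distinct vertices $u,v$, where $d(u,v)$ is the graph distance. So for $t=2$: adjacent vertices receive disjoint labels and vertices at distance $2$ receive distinct labels. The $t$-tone chromatic number $\tau_t(G)$ is the least $k$ such that $G$ has a $t$-tone $k$-coloring. $\chi$ denotes the ordinary chromatic number. $G_{n,p}$ is the Erdős–Rényi random graph on vertex set $[n]$ in which each pair is an edge independently with probability $p$. ''With high probability'' (w.h.p.) means with probability tending to $1$ as $n\to\infty$. *)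

(* Defs.v *)
From mathcomp Require Import all_boot.
From Stdlib Require Import Reals.

Set Implicit Arguments.
Unset Strict Implicit.
Unset Printing Implicit Defensive.

(* A simple graph on vertex set 'I_n (= [n]) is encoded by its edge set E,
   a set of pairs (i,j) with i < j, each pair standing for the edge {i,j}. *)
Definition edge_ok n (E : {set 'I_n * 'I_n}) : bool :=
  [forall x in E, (x.1 < x.2)%N].

Definition adj n (E : {set 'I_n * 'I_n}) (u v : 'I_n) : bool :=
  ((u, v) \in E) || ((v, u) \in E).

Fixpoint ball n (E : {set 'I_n * 'I_n}) (u : 'I_n) (k : nat) : {set 'I_n} :=
  match k with
  | 0 => [set u]
  | k'.+1 => ball E u k' :|: [set y | [exists x in ball E u k', adj E x y]]
  end.

(* d(u,v) <= k  (d = graph distance, +infinity if disconnected) *)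
Definition dist_le n (E : {set 'I_n * 'I_n}) (u v : 'I_n) (k : nat) : bool :=
  v \in ball E u k.

(* f is a t-tone k-coloring: |f v| = t and |f u ∩ f v| < d(u,v) for u <> v,
   i.e. NOT (d(u,v) <= |f u ∩ f v|). *)
Definition is_tone_coloring n (E : {set 'I_n * 'I_n}) (t k : nat)
    (f : {ffun 'I_n -> {set 'I_k}}) : bool :=
  [forall v, #|f v| == t] &&
  [forall u, forall v, (u != v) ==> ~~ dist_le E u v #|f u :&: f v|].

Definition tone_colorable n (E : {set 'I_n * 'I_n}) (t k : nat) : bool :=
  [exists f : {ffun 'I_n -> {set 'I_k}}, is_tone_coloring E t f].

(* tau_t(G) = least k with a t-tone k-coloring (k = t*n always works). *)
Definition tau n (t : nat) (E : {set 'I_n * 'I_n}) : nat :=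
  find (tone_colorable E t) (iota 0 (t * n).+1).

Definition colorable n (E : {set 'I_n * 'I_n}) (k : nat) : bool :=
  [exists f : {ffun 'I_n -> 'I_k}, [forall u, forall v, adj E u v ==> (f u != f v)]].

(* chi(G) = least k with a proper k-coloring (k = n always works). *)
Definition chi n (E : {set 'I_n * 'I_n}) : nat :=
  find (colorable E) (iota 0 n.+1).

Definition gnp_weight n (p : R) (E : {set 'I_n * 'I_n}) : R :=
  (p ^ #|E| * (1 - p) ^ ('C(n, 2) - #|E|)%nat)%R.

Definition gnp_prob n (p : R) (A : {set 'I_n * 'I_n} -> bool) : R :=
  \big[Rplus/0%R]_(E : {set 'I_n * 'I_n} | edge_ok E && A E) gnp_weight p E.

Definition Rleb (x y : R) : bool := if Rle_dec x y then true else false.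

(* Main.v *)
(* Let [a] and [k] be [(1 + eta)] and [(1 - eta)] times [2 log_b(np)], where
   [b = 1 / (1 - p)].  With high probability no independent set has more than [a]
   vertices, and since every color class, ordinary or 2-tone, is independent,
   [chi >= n / a] and [tau_2 >= 2 n / a].

   For the upper bounds fix [m ~ n / (ln n)^(3/2)].  Janson's inequality bounds by
   [exp (- c n (ln n)^2)] the probability that a given [m]-set [W] contains no
   independent [k]-set meeting every class of a given partition at most once
   (classes of size at most [a]).  This beats the [2^n n^n] choices of [W] and of
   the partition, so with high probability it happens for none.  Removing such
   [k]-sets greedily, and coloring the last [m] vertices greedily by degeneracy with
   [O(mp) = o(n / a)] colors, gives a proper coloring with [(1 + o(1)) n / k] colors
   whose classes moreover meet each class of the given partition at most once.
   Doing this for the trivial partition yields a coloring [f]; doing it again for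
   the partition into the classes of [f] yields [g].  Labelling [v] by
   [{f v, g v}], with disjoint palettes, is a 2-tone coloring, as distinct vertices
   never share both colors. *)
From Stdlib Require Import ZArith Reals Lra Lia Psatz.

(** * Choice of the parameters *)

Local Open Scope R_scope.

(** The partition must enter the union bound because the second coloring is built from the classes
    of [f], which depend on the same graph: no fresh randomness is left for it. Janson's exponent
    must therefore beat [ln (n^n 2^n)], and this produces the range of [p]. The exponent is the
    reciprocal of a normalised second moment whose bound is governed by pairs of [k]-sets sharing
    just two vertices, so it is at least of order [(m / k^2)^2]. Write [L = ln n]. With
    [k <= 2 L / p] and [m] about [n / L^(3/2)] this is of order [n^2 p^4 / L^7], and [n p^4 >= L^9]
    makes it a multiple of [n L^2]: hence the power [9/4]. Only a large multiple of [n L] is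
    required, so the spare factor [L] absorbs all constants and [C0 = 1] suffices. The size of [m]
    is limited from above by the leftover vertices: [O(m p)] colors must be negligible against
    [n / a], which is of order [n p / L]. So [m = o(n / L)] is needed, and the extra [sqrt L]
    provides it. *)

Lemma nat_floor (y : R) : 0 <= y -> exists k : nat, INR k <= y < INR k + 1.
Proof.
intros Hy. destruct (archimed y) as [H1 H2].
assert (Hz : (0 < up y)%Z) by (apply lt_IZR; simpl; lra).
exists (Z.to_nat (up y - 1)).
rewrite INR_IZR_INZ, Z2Nat.id by lia. rewrite minus_IZR. lra.
Qed.

Lemma nat_ceil (y : R) : 0 <= y -> exists a : nat, y <= INR a <= y + 1.
Proof.
intros Hy. destruct (nat_floor y Hy) as [k Hk].
exists (S k). rewrite S_INR. lra.
Qed.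

Lemma exp_le_compat (x y : R) : x <= y -> exp x <= exp y.
Proof. intros [H | ->]; [left; now apply exp_increasing | lra]. Qed.

Lemma exp_pow_INR (x : R) (n : nat) : exp x ^ n = exp (INR n * x).
Proof.
induction n as [|n IH]; [now rewrite Rmult_0_l, exp_0 | ].
rewrite S_INR; simpl pow; rewrite IH, <- exp_plus. f_equal. ring.
Qed.

(** With [d = c / (j + 1)], [exp (c L)] is the [(j + 1)]-st power of [exp (d L) >= d L]; one of the
    [j + 1] factors [L] is spent on absorbing [A]. *)
Lemma exp_dominates_power (A c : R) (j : nat) : 0 < c ->
  exists L0 : R, forall L, L0 <= L -> A * L ^ j <= exp (c * L).
Proof.
intros Hc. set (d := c / INR (S j)).
assert (HS : 0 < INR (S j)) by (apply lt_0_INR; lia).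
assert (Hd : 0 < d) by now apply Rdiv_lt_0_compat.
assert (Hdj : 0 < d ^ S j) by now apply pow_lt.
exists (Rmax 0 (A / d ^ S j)). intros L HL.
assert (HL0 : 0 <= L) by (eapply Rle_trans; [apply Rmax_l | apply HL]).
assert (HLA : A / d ^ S j <= L) by (eapply Rle_trans; [apply Rmax_r | apply HL]).
assert (HA : A <= L * d ^ S j).
{ apply Rmult_le_compat_r with (r := d ^ S j) in HLA; [ | lra].
  unfold Rdiv in HLA. rewrite Rmult_assoc, Rinv_l, Rmult_1_r in HLA; lra. }
apply Rle_trans with ((d * L) ^ S j).
- rewrite Rpow_mult_distr. simpl (L ^ S j).
  apply Rle_trans with (L * d ^ S j * L ^ j); [ | right; ring].
  apply Rmult_le_compat_r; [now apply pow_le | lra].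
- replace (c * L) with (INR (S j) * (d * L)) by (unfold d; field; lra).
  rewrite <- exp_pow_INR. apply pow_incr. split; [apply Rmult_le_pos; lra | ].
  generalize (exp_ineq1_le (d * L)). lra.
Qed.

Lemma neg_ln_one_sub_bounds (p eps : R) : 0 < p < eps -> eps < 1 ->
  p <= - ln (1 - p) <= p / (1 - eps).
Proof.
intros Hp He.
assert (ln_le_sub : forall y, 0 < y -> ln y <= y - 1).
{ intros y Hy. generalize (exp_ineq1_le (ln y)). rewrite exp_ln; lra. }
split; [generalize (ln_le_sub (1 - p)); lra | ].
rewrite <- ln_Rinv by lra.
apply Rle_trans with (/ (1 - p) - 1).
- apply ln_le_sub. apply Rinv_0_lt_compat. lra.
- apply Rle_trans with (p / (1 - p)); [right; field; lra | ].
  apply Rmult_le_compat_l; [lra | ]. apply Rinv_le_contravar; lra.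
Qed.

Lemma le_div (x y z : R) : 0 < z -> x * z <= y -> x <= y / z.
Proof.
intros Hz H. apply Rmult_le_reg_r with z; [easy | ].
unfold Rdiv. rewrite Rmult_assoc, Rinv_l; lra.
Qed.

Lemma div_le (x y z : R) : 0 < z -> x <= y * z -> x / z <= y.
Proof.
intros Hz H. apply Rmult_le_reg_r with z; [easy | ].
unfold Rdiv. rewrite Rmult_assoc, Rinv_l; lra.
Qed.

(* The [l]-th power of this bounds [overlap p m k l] below. *)
Definition overlap_base (p k m l : R) : R :=
  exp 1 * k / l * (k / m) * exp (- ln (1 - p) / 2 * l).

(* Dictionary: [x = n], [L = ln n], [u = n^(1/4)], [ell = ln (n p)], [lam = 2 log_b (n p)]
   with [b = 1 / (1 - p)] and [Lam = ln b].  Up to rounding, [k = (1 - eta) lam],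
   [a = (1 + eta) lam], [m = n / L^(3/2)] and [D = 8 m p].  Overlaps of size at most
   [l0] are bounded by [X], larger ones by a negative power [rho] of [n]. *)
Section Asymptotics.
Variables (eps delta : R).
Hypothesis (eps0 : 0 < eps < 1) (delta0 : 0 < delta <= 1).
Let eta := delta / 40.
Let mu := 1 - eps.
Variable (l0 : nat).
(** With [rho = n^(-eta/2)] below, this gives [rho ^ l0 <= n^(-3)]; multiplied by [k <= n], the
    large overlaps cost at most [n^(-2) <= X ^ 2]. *)
Hypothesis (Hl0 : 6 <= INR l0 * eta).
(** The [3] bounds [e]; the exponential bounds [(1 - p)^(-l/2)] for [l <= l0], because
    [Lam <= p / mu <= 1 / mu]. The constant [A] is chosen so that [8 (l0 + 1) X^2 = A k^4 / m^2]. *)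
Let G := 3 * exp (INR l0 / (2 * mu)).
Let A := 8 * (INR l0 + 1) * G ^ 2.

Variables (n : nat) (p L u s : R).
Hypothesis (Hp : 0 < p < eps).
Hypothesis (HL4 : 4 <= L).
Hypothesis (Hn : INR n = exp L).
Hypothesis (Hu : u = exp (L / 4)).
Hypothesis (Hs : s = sqrt L).
Hypothesis (Hpu : 1 <= p * u).
Hypothesis (Hp4 : L ^ 9 <= p ^ 4 * exp L).
(** The conditions [g1] to [g8] hold for all large [L], with a threshold depending only on [eps],
    [delta] and [l0]. Assuming them here lets every estimate of the section concern one fixed
    [n]. *)
Hypothesis (g1 : 32 * L ^ 5 < u).
Hypothesis (g2 : 4 * G * L ^ 4 <= u).
Hypothesis (g3 : 12 * L ^ 4 <= exp (1 / 8 * L)).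
Hypothesis (g4 : 24 * L ^ 3 <= exp (eta / 4 * L)).
Hypothesis (g5 : 48 * A <= L).
Hypothesis (g6 : 512 <= delta * s).
Hypothesis (g7 : 4 <= eta * (mu * L)).
Hypothesis (g8 : 256 * L ^ 2 <= delta * u).

Let x := exp L.
Let ell := L + ln p.
Let Lam := - ln (1 - p).
Let lam := 2 * ell / Lam.

Lemma eta_bounds : 0 < eta <= 1 / 40. Proof. unfold eta; lra. Qed.
Lemma mu_bounds : 0 < mu < 1. Proof. unfold mu; lra. Qed.
Lemma u_ge1 : 1 <= u.
Proof.
rewrite Hu. rewrite <- exp_0. apply exp_le_compat. lra.
Qed.
Lemma x_eq_u4 : x = u ^ 4.
Proof. rewrite Hu, exp_pow_INR. unfold x. f_equal. simpl. field. Qed.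
Lemma s_bounds : s * s = L /\ 2 <= s /\ s <= L.
Proof.
assert (H : s * s = L) by (rewrite Hs; apply sqrt_sqrt; lra).
assert (0 <= s) by (rewrite Hs; apply sqrt_pos).
repeat split; try easy; nra.
Qed.
Lemma Lam_bounds : p <= Lam /\ Lam * mu <= p.
Proof.
destruct (neg_ln_one_sub_bounds p eps Hp (proj2 eps0)) as [H1 H2].
split; [exact H1 | ]. fold Lam in H2. fold mu in H2.
apply Rmult_le_compat_r with (r := mu) in H2; [ | generalize mu_bounds; lra].
replace (p / mu * mu) with p in H2 by (field; generalize mu_bounds; lra). exact H2.
Qed.
Lemma exp_ell : exp ell = x * p.
Proof. unfold ell. rewrite exp_plus, exp_ln by lra. reflexivity. Qed.
(** The [3/4] reflects [p >= n^(-1/4)], which is [1 <= p * u]. *)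
Lemma ell_bounds : 3 / 4 * L <= ell <= L.
Proof.
split.
- assert (H : ln (/ u) <= ln p).
  { assert (Hu0 := u_ge1). assert (0 < / u) by (apply Rinv_0_lt_compat; lra).
    assert (H1 : / u <= p) by (apply Rmult_le_reg_r with u; [lra | rewrite Rinv_l; lra]).
    destruct H1 as [H1 | <-]; [left; now apply ln_increasing | lra]. }
  rewrite ln_Rinv in H by (generalize u_ge1; lra).
  rewrite Hu, ln_exp in H. unfold ell. lra.
- unfold ell. assert (ln p < 0); [ | lra].
  rewrite <- ln_1. apply ln_increasing; lra.
Qed.
(** The last bound makes [1 <= eta * lam], so rounding [k] and [a] to integers costs at most one
    more [eta]; this explains the [2 * eta] in [k_bounds] and [a_bounds]. *)
Lemma lam_bounds : lam * Lam = 2 * ell /\ lam * p <= 2 * L /\ 4 <= eta * lam.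
Proof.
destruct Lam_bounds as [H1 H2]. destruct ell_bounds as [H3 H4].
assert (E : lam * Lam = 2 * ell) by (unfold lam; field; lra).
assert (M := mu_bounds). assert (Et := eta_bounds).
assert (lam0 : 0 <= lam).
{ unfold lam. apply Rle_mult_inv_pos; lra. }
repeat split; [exact E | nra | ].
assert (H5 : mu * L <= lam).
{ apply Rmult_le_reg_r with Lam; [lra | ]. rewrite E. nra. }
apply Rle_trans with (1 := g7). apply Rmult_le_compat_l; lra.
Qed.

Variables (k a m D : nat).
Hypothesis (Hk : INR k <= (1 - eta) * lam < INR k + 1).
Hypothesis (Ha : (1 + eta) * lam <= INR a <= (1 + eta) * lam + 1).
Hypothesis (Hm : x / (L * s) <= INR m <= x / (L * s) + 1).
Hypothesis (HD : 8 * INR m * p <= INR D <= 8 * INR m * p + 1).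

Lemma k_bounds : 3 <= INR k /\ INR k <= lam /\ INR k * p <= 2 * L /\ INR k <= 2 * L * u
  /\ (1 - 2 * eta) * lam <= INR k.
Proof.
destruct lam_bounds as [E [H1 H2]]. assert (Et := eta_bounds).
assert (lam0 : 160 <= lam) by nra.
assert (K : INR k <= lam) by nra.
assert (Kp : INR k * p <= 2 * L) by (apply Rle_trans with (2 := H1); apply Rmult_le_compat_r; lra).
assert (k0 := pos_INR k).
assert (Ku : INR k <= INR k * p * u).
{ rewrite Rmult_assoc. rewrite <- (Rmult_1_r (INR k)) at 1.
  apply Rmult_le_compat_l; lra. }
assert (Ku2 : INR k * p * u <= 2 * L * u).
{ apply Rmult_le_compat_r; [generalize u_ge1; lra | lra]. }
repeat split; try lra; nra.
Qed.

Lemma a_bounds : 100 <= INR a /\ lam <= INR a /\ INR a * p <= 4 * L /\ INR a <= 4 * L * u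
  /\ INR a <= (1 + 2 * eta) * lam.
Proof.
destruct lam_bounds as [E [H1 H2]]. assert (Et := eta_bounds).
assert (lam0 : 160 <= lam) by nra.
assert (K : INR a <= 2 * lam) by nra.
assert (Kp : INR a * p <= 4 * L).
{ apply Rle_trans with (2 * lam * p); [apply Rmult_le_compat_r; lra | lra]. }
assert (k0 := pos_INR a).
assert (Ku : INR a <= INR a * p * u).
{ rewrite Rmult_assoc. rewrite <- (Rmult_1_r (INR a)) at 1.
  apply Rmult_le_compat_l; lra. }
assert (Ku2 : INR a * p * u <= 4 * L * u).
{ apply Rmult_le_compat_r; [generalize u_ge1; lra | lra]. }
repeat split; try lra; nra.
Qed.

Lemma L_powers_bounds : 1 <= L ^ 2 /\ L <= L ^ 5 /\ L^2 <= L^5 /\ L ^ 2 <= u.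
Proof.
assert (H2 : 16 <= L ^ 2) by nra.
assert (H4 : 1 <= L ^ 4) by (apply pow_R1_Rle; lra).
assert (H3 : 1 <= L ^ 3) by (apply pow_R1_Rle; lra).
assert (H5 : L <= L ^ 5).
{ replace (L ^ 5) with (L * L ^ 4) by ring. nra. }
assert (H6 : L ^ 2 <= L ^ 5).
{ replace (L ^ 5) with (L ^ 2 * L ^ 3) by ring. nra. }
repeat split; lra.
Qed.

Lemma m_bounds : x <= INR m * (L * s) /\ x <= INR m * L ^ 2 /\
  INR m * (L * s) <= 2 * x /\ INR m <= x /\ 0 < INR m.
Proof.
destruct s_bounds as [S1 [S2 S3]]. assert (X := x_eq_u4). assert (U := u_ge1).
destruct L_powers_bounds as [P1 [P2 [P3 P4]]].
assert (x0 : 0 < x) by apply exp_pos.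
assert (Ls : 0 < L * s) by nra.
assert (E : x / (L * s) * (L * s) = x) by (field; nra).
assert (M1 : x <= INR m * (L * s)).
{ rewrite <- E at 1. apply Rmult_le_compat_r; lra. }
assert (m0 : 0 < INR m).
{ destruct (Rle_lt_or_eq_dec 0 (INR m) (pos_INR m)) as [|F]; [easy | ].
  rewrite <- F in M1. lra. }
assert (LsL : L * s <= L ^ 2) by nra.
assert (Lx : L ^ 2 <= x).
{ rewrite X. apply Rle_trans with (1 := P4).
  replace (u ^ 4) with (u * (u * u ^ 2)) by ring.
  assert (1 <= u ^ 2) by (apply pow_R1_Rle; lra). nra. }
assert (M2 : INR m * (L * s) <= 2 * x).
{ apply Rle_trans with ((x / (L * s) + 1) * (L * s)); [apply Rmult_le_compat_r; lra | ].
  rewrite Rmult_plus_distr_r, E. lra. }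
repeat split; try easy.
- apply Rle_trans with (1 := M1). apply Rmult_le_compat_l; lra.
- assert (2 <= L * s) by nra. nra.
Qed.

(** Up to powers of [L] the left side is at most [n^(3/4)]. The inequality guarantees that at least
    half of the [k]-subsets of an [m]-set are transversal to a partition into classes of size at
    most [a]. *)
Lemma two_a_k_sqr_lt_m : 2 * INR a * INR k ^ 2 < INR m.
Proof.
destruct a_bounds as [_ [_ [_ [A1 _]]]]. destruct k_bounds as [K0 [_ [_ [K1 _]]]].
destruct m_bounds as [_ [M _]]. assert (U := u_ge1). assert (X := x_eq_u4).
assert (L2 : 0 < L ^ 2) by (apply pow_lt; lra).
apply Rmult_lt_reg_r with (L ^ 2); [easy | ].
apply Rlt_le_trans with (2 := M). rewrite X.
assert (u3 : 0 < u ^ 3) by (apply pow_lt; lra).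
apply Rle_lt_trans with (32 * L ^ 5 * u ^ 3).
- apply Rle_trans with (2 * (4 * L * u) * (2 * L * u) ^ 2 * L ^ 2); [ | right; ring].
  apply Rmult_le_compat_r; [lra | ].
  apply Rmult_le_compat; [generalize (pos_INR a); lra | apply pow_le; lra | lra | ].
  apply pow_incr. lra.
- replace (u ^ 4) with (u * u ^ 3) by ring. apply Rmult_lt_compat_r; lra.
Qed.

Lemma k_le_m : INR k <= INR m.
Proof.
assert (H := two_a_k_sqr_lt_m). destruct a_bounds as [A0 _]. destruct k_bounds as [K0 _]. nra.
Qed.

(** The bracket bounds the number of colors used by each coloring. The relative errors are
    [delta / 4] from [a / k], [delta / 8] from the leftover vertices and [delta / 8] from [a] and
    the roundings; doubled, they add up to [delta]. *)
Lemma color_count_le : 2 * INR a * (INR n / INR k + INR D + INR a + 1) <= (2 + delta) * INR n.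
Proof.
destruct a_bounds as [A0 [_ [A1 [A2 A3]]]]. destruct k_bounds as [K0 [K1 [K2 [K3 K4]]]].
destruct m_bounds as [M0 [_ [M1 [M2 M3]]]]. destruct lam_bounds as [_ [_ La]].
destruct s_bounds as [S1 [S2 S3]].
assert (U := u_ge1). assert (X := x_eq_u4). assert (Et := eta_bounds).
assert (x0 : 0 < x) by apply exp_pos.
rewrite Hn; fold x.
assert (B1 : INR a * (x / INR k) <= (1 + delta / 4) * x).
{ assert (INR a <= (1 + delta / 4) * INR k).
  { apply Rle_trans with (1 := A3).
    apply Rle_trans with ((1 + delta / 4) * ((1 - 2 * eta) * lam));
      [ | apply Rmult_le_compat_l; lra].
    rewrite <- Rmult_assoc. apply Rmult_le_compat_r; [lra | ].
    assert (delta * delta <= delta) by nra. unfold eta. lra. }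
  replace (INR a * (x / INR k)) with (INR a * x / INR k) by (field; lra).
  apply div_le; [lra | ].
  apply Rle_trans with ((1 + delta / 4) * INR k * x);
    [apply Rmult_le_compat_r; lra | right; ring]. }
(* Here [a p <= 4 L] meets [m <= 2 n / (L s)]: what remains is [64 / s], so the factor [s = sqrt L]
   in the choice of [m] makes the term negligible. *)
assert (B2 : INR a * (8 * INR m * p) <= delta / 8 * x).
{ apply Rmult_le_reg_r with (L * s); [nra | ].
  apply Rle_trans with (8 * (INR a * p) * (INR m * (L * s))); [right; ring | ].
  apply Rle_trans with (8 * (4 * L) * (2 * x)).
  - assert (0 <= INR a * p) by (apply Rmult_le_pos; lra).
    apply Rmult_le_compat; lra.
  - apply Rle_trans with (64 * L * x); [right; ring | ].
    apply Rle_trans with (delta * s / 8 * (L * x)); [ | right; field].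
    apply Rle_trans with (64 * (L * x)); [right; ring | ].
    apply Rmult_le_compat_r; [nra | lra]. }
(* The [2] collects the explicit [+ 1] and the rounding error of [D]. *)
assert (B3 : INR a * (INR a + 2) <= delta / 8 * x).
{ apply Rle_trans with (2 * INR a ^ 2); [nra | ].
  apply Rle_trans with (2 * (4 * L * u) ^ 2).
  - apply Rmult_le_compat_l; [lra | apply pow_incr; lra].
  - rewrite X. apply Rle_trans with (delta * u / 8 * u ^ 2).
    + replace (2 * (4 * L * u) ^ 2) with (32 * L ^ 2 * u ^ 2) by ring.
      apply Rmult_le_compat_r; [nra | lra].
    + replace (delta / 8 * u ^ 4) with (delta * u / 8 * u ^ 2 * u) by field.
      assert (0 <= delta * u / 8 * u ^ 2).
      { apply Rmult_le_pos; [nra | apply pow_le; lra]. }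
      rewrite <- (Rmult_1_r (delta * u / 8 * u ^ 2)) at 1.
      apply Rmult_le_compat_l; lra. }
assert (B4 : INR a * INR D <= INR a * (8 * INR m * p + 1)).
{ apply Rmult_le_compat_l; lra. }
nra.
Qed.

Lemma G_ge3 : 3 <= G.
Proof.
unfold G. assert (H : exp 0 <= exp (INR l0 / (2 * mu))).
{ apply exp_le_compat. apply Rle_mult_inv_pos; [apply pos_INR | generalize mu_bounds; lra]. }
rewrite exp_0 in H. lra.
Qed.

(** Overlaps have size [l >= 2], so with [X <= 1] the [l]-th power is at most [X ^ 2], which is of
    order [k^4 / m^2]. *)
Let X := G * INR k ^ 2 / INR m.
Let rho := exp (- (eta / 2 * L)).

Lemma X_bounds : 0 < X <= 1.
Proof.
destruct m_bounds as [_ [M [_ [_ M0]]]]. destruct k_bounds as [K0 [_ [_ [K1 _]]]].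
assert (U := u_ge1). assert (Xx := x_eq_u4). assert (G0 := G_ge3).
assert (Kk : 0 < INR k ^ 2) by (apply pow_lt; lra).
split; [apply Rdiv_lt_0_compat; [apply Rmult_lt_0_compat; lra | lra] | ].
apply div_le; [lra | ]. rewrite Rmult_1_l.
assert (L2 : 0 < L ^ 2) by (apply pow_lt; lra).
apply Rmult_le_reg_r with (L ^ 2); [lra | ].
apply Rle_trans with (2 := M). rewrite Xx.
apply Rle_trans with (G * (2 * L * u) ^ 2 * L ^ 2).
- apply Rmult_le_compat_r; [lra | ]. apply Rmult_le_compat_l; [lra | ].
  apply pow_incr. lra.
- apply Rle_trans with (4 * G * L ^ 4 * u ^ 2); [right; ring | ].
  apply Rle_trans with (u * u ^ 2).
  + apply Rmult_le_compat_r; [apply pow_le; lra | lra].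
  + replace (u ^ 4) with (u * (u * u ^ 2)) by ring.
    assert (0 < u * u ^ 2) by (apply Rmult_lt_0_compat; [lra | apply pow_lt; lra]).
    nra.
Qed.

Lemma overlap_base_le (l : nat) (y : R) : 1 <= INR l -> exp (Lam / 2 * INR l) <= y ->
  overlap_base p (INR k) (INR m) (INR l) <= 3 * (INR k / INR l) * (INR k / INR m) * y.
Proof.
intros Hl Hy. unfold overlap_base. fold Lam.
destruct m_bounds as [_ [_ [_ [_ M0]]]]. destruct k_bounds as [K0 _].
assert (E0 := exp_pos (Lam / 2 * INR l)).
assert (e3 := exp_le_3).
assert (kl : 0 <= INR k / INR l) by (apply Rle_mult_inv_pos; lra).
assert (km : 0 <= INR k / INR m) by (apply Rle_mult_inv_pos; lra).
apply Rmult_le_compat; [ | lra | | exact Hy].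
- apply Rmult_le_pos; [ | exact km]. unfold Rdiv. rewrite Rmult_assoc.
  apply Rmult_le_pos; [left; apply exp_pos | exact kl].
- apply Rmult_le_compat_r; [exact km | ]. unfold Rdiv. rewrite Rmult_assoc.
  apply Rmult_le_compat_r; [exact kl | exact e3].
Qed.

Lemma overlap_base_small (l : nat) : 2 <= INR l <= INR k -> INR l <= INR l0 ->
  overlap_base p (INR k) (INR m) (INR l) <= X.
Proof.
intros Hl Hll. destruct m_bounds as [_ [_ [_ [_ M0]]]]. destruct k_bounds as [K0 _].
destruct Lam_bounds as [La1 La2]. assert (Mu := mu_bounds).
eapply Rle_trans; [apply overlap_base_le with (y := exp (INR l0 / (2 * mu))); [lra | ] | ].
- apply exp_le_compat. apply le_div; [lra | ].
  apply Rle_trans with ((Lam * mu) * INR l); [right; field | ].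
  apply Rle_trans with (1 * INR l); [apply Rmult_le_compat_r; lra | lra].
- unfold X, G.
  replace (3 * exp (INR l0 / (2 * mu)) * INR k ^ 2 / INR m)
    with (3 * exp (INR l0 / (2 * mu)) * (INR k / INR m) * INR k) by (field; lra).
  replace (3 * (INR k / INR l) * (INR k / INR m) * exp (INR l0 / (2 * mu)))
    with (3 * exp (INR l0 / (2 * mu)) * (INR k / INR m) * (INR k / INR l)) by (field; lra).
  apply Rmult_le_compat_l.
  + apply Rmult_le_pos; [generalize (exp_pos (INR l0 / (2 * mu))); lra | ].
    apply Rle_mult_inv_pos; lra.
  + apply div_le; nra.
Qed.

(** Two regimes. While [(1 - p)^(-l/2) <= (n p)^(1/4)], this factor is at most [u = n^(1/4)] and
    [k^2 / m] is [n^(-1/2)] up to powers of [L]. Beyond that, [l >= k / 4], and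
    [l <= k <= (1 - eta) lam] bounds the factor by [(n p)^(1 - eta)]; since [(k / m) n p] is at most
    a power of [L], the gain [(n p)^(-eta)] wins. *)
Lemma overlap_base_large (l : nat) : 2 <= INR l <= INR k ->
  overlap_base p (INR k) (INR m) (INR l) <= rho.
Proof.
intros Hl. destruct m_bounds as [_ [M [_ [_ M0]]]].
destruct k_bounds as [K0 [K1 [K2 [K3 _]]]].
destruct Lam_bounds as [La1 La2]. assert (Mu := mu_bounds).
destruct ell_bounds as [El1 El2]. assert (Et := eta_bounds).
assert (U := u_ge1). assert (Xx := x_eq_u4).
destruct lam_bounds as [E [_ _]].
assert (x0 : 0 < x) by apply exp_pos.
assert (L2 : 0 < L ^ 2) by (apply pow_lt; lra).
assert (km : 0 <= INR k / INR m) by (apply Rle_mult_inv_pos; lra).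
destruct (Rle_dec (Lam / 2 * INR l) (ell / 4)) as [H | H].
- eapply Rle_trans; [apply overlap_base_le with (y := u); [lra | ] | ].
  + rewrite Hu. apply exp_le_compat. lra.
  + apply Rle_trans with (12 * L ^ 4 / u).
    * apply le_div; [lra | ].
      apply Rle_trans with (3 * INR k * (INR k / INR m) * u * u).
      { apply Rmult_le_compat_r; [lra | ]. apply Rmult_le_compat_r; [lra | ].
        apply Rmult_le_compat_r; [lra | ]. apply Rmult_le_compat_l; [lra | ].
        apply div_le; nra. }
      replace (3 * INR k * (INR k / INR m) * u * u) with (3 * INR k ^ 2 * u ^ 2 / INR m)
        by (field; lra).
      apply div_le; [lra | ].
      apply Rle_trans with (3 * (2 * L * u) ^ 2 * u ^ 2).
      { apply Rmult_le_compat_r; [apply pow_le; lra | ].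
        apply Rmult_le_compat_l; [lra | ]. apply pow_incr; lra. }
      replace (3 * (2 * L * u) ^ 2 * u ^ 2) with (12 * L ^ 2 * u ^ 4) by ring.
      rewrite <- Xx.
      replace (12 * L ^ 4 * INR m) with (12 * L ^ 2 * (INR m * L ^ 2)) by ring.
      apply Rmult_le_compat_l; lra.
    * apply div_le; [lra | ]. apply Rle_trans with (1 := g3).
      rewrite Hu. unfold rho. rewrite <- exp_plus. apply exp_le_compat. nra.
- assert (kl : INR k / INR l <= 4).
  { apply div_le; [lra | ]. apply Rle_trans with (1 := K1).
    apply Rmult_le_reg_r with Lam; [lra | ]. rewrite E. lra. }
  eapply Rle_trans; [apply overlap_base_le with (y := x * p * exp (- eta * ell)); [lra | ] | ].
  + rewrite <- exp_ell, <- exp_plus. apply exp_le_compat.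
    apply Rle_trans with (Lam / 2 * ((1 - eta) * lam)).
    * apply Rmult_le_compat_l; lra.
    * replace (Lam / 2 * ((1 - eta) * lam)) with ((1 - eta) / 2 * (lam * Lam)) by field.
      rewrite E. lra.
  + assert (E1 : exp (- eta * ell) <= exp (- (eta * (3 / 4 * L)))).
    { apply exp_le_compat.
      assert (eta * (3 / 4 * L) <= eta * ell) by (apply Rmult_le_compat_l; lra).
      lra. }
    assert (E0 := exp_pos (- eta * ell)).
    assert (kmx : INR k / INR m * (x * p) <= 2 * L ^ 3).
    { replace (INR k / INR m * (x * p)) with (INR k * p * x / INR m) by (field; lra).
      apply div_le; [lra | ].
      apply Rle_trans with (2 * L * (INR m * L ^ 2)); [ | right; ring].
      assert (0 <= INR k * p) by (apply Rmult_le_pos; lra).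
      apply Rmult_le_compat; lra. }
    assert (kmx0 : 0 <= INR k / INR m * (x * p)).
    { apply Rmult_le_pos; [lra | ]. apply Rmult_le_pos; lra. }
    assert (kl0 : 0 <= INR k / INR l) by (apply Rle_mult_inv_pos; lra).
    apply Rle_trans with (3 * 4 * (2 * L ^ 3) * exp (- (eta * (3 / 4 * L)))).
    * replace (3 * (INR k / INR l) * (INR k / INR m) * (x * p * exp (- eta * ell)))
        with (3 * (INR k / INR l) * (INR k / INR m * (x * p)) * exp (- eta * ell)) by ring.
      apply Rmult_le_compat; [ | lra | | exact E1].
      { apply Rmult_le_pos; lra. }
      apply Rmult_le_compat; lra.
    * replace (3 * 4 * (2 * L ^ 3)) with (24 * L ^ 3) by ring.
      apply Rle_trans with (exp (eta / 4 * L) * exp (- (eta * (3 / 4 * L)))).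
      { apply Rmult_le_compat_r; [left; apply exp_pos | exact g4]. }
      rewrite <- exp_plus. unfold rho. right. f_equal. field.
Qed.

Lemma rho_bounds : 0 <= rho <= 1.
Proof.
unfold rho. split; [left; apply exp_pos | ]. rewrite <- exp_0.
apply exp_le_compat. generalize eta_bounds. nra.
Qed.

(** The term [2 n L] pays for the union bound over partitions and [m]-sets. Janson's term is at
    least [3 n L], leaving [- n L]. *)
Lemma transversal_failure_small :
  exp (2 * INR n * L - / (8 * (INR l0 * X ^ 2 + INR k * rho ^ l0))) <= exp (- L).
Proof.
assert (XX := X_bounds). assert (R0 := rho_bounds).
destruct m_bounds as [M1 [_ [_ [M2 M0]]]].
destruct k_bounds as [K0 [_ [K2 [K3 _]]]]. assert (Et := eta_bounds).
assert (G3 := G_ge3). assert (U := u_ge1). assert (Xx := x_eq_u4).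
destruct s_bounds as [S1 [S2 S3]].
assert (x0 : 0 < x) by apply exp_pos. assert (km := k_le_m).
assert (x1 : 1 <= x) by (rewrite Xx; apply pow_R1_Rle; lra).
assert (l00 := pos_INR l0).
apply exp_le_compat. rewrite Hn. fold x.
assert (B1 : INR k * rho ^ l0 <= X ^ 2).
{ apply Rle_trans with (x * / x ^ 3).
  - apply Rmult_le_compat; [lra | apply pow_le; lra | lra | ].
    unfold rho. rewrite exp_pow_INR.
    replace (/ x ^ 3) with (exp (- (3 * L))).
    + apply exp_le_compat. nra.
    + rewrite exp_Ropp. f_equal. unfold x. rewrite exp_pow_INR. f_equal. simpl. ring.
  - replace (x * / x ^ 3) with ((/ x) ^ 2) by (field; lra).
    apply pow_incr. split; [left; now apply Rinv_0_lt_compat | ].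
    unfold X. apply le_div; [lra | ].
    apply Rle_trans with (/ x * x);
      [apply Rmult_le_compat_l; [left; now apply Rinv_0_lt_compat | lra] | ].
    rewrite Rinv_l by lra. assert (1 <= INR k ^ 2) by nra. nra. }
assert (B2 : 8 * (INR l0 * X ^ 2 + INR k * rho ^ l0) <= 8 * (INR l0 + 1) * X ^ 2) by lra.
assert (P0 : 0 < 8 * (INR l0 * X ^ 2 + INR k * rho ^ l0)).
{ assert (0 < INR k * rho ^ l0).
  { apply Rmult_lt_0_compat; [lra | ]. apply pow_lt. apply exp_pos. }
  assert (0 <= INR l0 * X ^ 2) by (apply Rmult_le_pos; [lra | apply pow_le; lra]).
  lra. }
assert (B3 : 3 * x * L <= / (8 * (INR l0 * X ^ 2 + INR k * rho ^ l0))).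
{ apply Rle_trans with (/ (8 * (INR l0 + 1) * X ^ 2)); [ | now apply Rinv_le_contravar].
  assert (Q : 8 * (INR l0 + 1) * X ^ 2 = A * INR k ^ 4 / INR m ^ 2).
  { unfold X, A. field. lra. }
  assert (A0 : 0 < A).
  { unfold A. apply Rmult_lt_0_compat; [lra | apply pow_lt; lra]. }
  assert (k4 : 0 < INR k ^ 4) by (apply pow_lt; lra).
  rewrite Q.
  replace (/ (A * INR k ^ 4 / INR m ^ 2)) with (INR m ^ 2 / (A * INR k ^ 4))
    by (field; repeat split; lra).
  apply le_div; [apply Rmult_lt_0_compat; lra | ].
  assert (p4 : 0 < p ^ 4) by (apply pow_lt; lra).
  (* This is where the lower bound on [p] is used at full strength: [(k p)^4 <= 16 L^4] is combined
     with [L^9 <= p^4 n]. *)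
  assert (C1 : INR k ^ 4 * L ^ 5 <= 16 * x).
  { apply Rmult_le_reg_r with (p ^ 4 * L ^ 4).
    { apply Rmult_lt_0_compat; [lra | apply pow_lt; lra]. }
    replace (INR k ^ 4 * L ^ 5 * (p ^ 4 * L ^ 4)) with ((INR k * p) ^ 4 * L ^ 9) by ring.
    replace (16 * x * (p ^ 4 * L ^ 4)) with ((2 * L) ^ 4 * (p ^ 4 * x)) by ring.
    apply Rmult_le_compat; [ | | | exact Hp4].
    - apply pow_le. apply Rmult_le_pos; lra.
    - apply pow_le. lra.
    - apply pow_incr. split; [apply Rmult_le_pos; lra | lra]. }
  assert (C2 : x ^ 2 <= INR m ^ 2 * L ^ 3).
  { replace (INR m ^ 2 * L ^ 3) with ((INR m * (L * s)) ^ 2)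
      by (rewrite <- S1; ring).
    apply pow_incr. lra. }
  apply Rmult_le_reg_r with (L ^ 4); [apply pow_lt; lra | ].
  apply Rle_trans with (3 * x * A * (INR k ^ 4 * L ^ 5)); [right; ring | ].
  assert (xA : 0 <= 3 * x * A) by (apply Rmult_le_pos; lra).
  apply Rle_trans with (3 * x * A * (16 * x)); [apply Rmult_le_compat_l; lra | ].
  apply Rle_trans with (48 * A * x ^ 2); [right; ring | ].
  apply Rle_trans with (L * (INR m ^ 2 * L ^ 3)); [ | right; ring].
  apply Rmult_le_compat; [lra | apply pow_le; lra | exact g5 | exact C2]. }
nra.
Qed.

(** Since [a >= (1 + eta) lam], the factor [(1 - p)^(a/2)] is at most [(n p)^(-1 - eta)]. One power
    of [n p] cancels [n] and turns [a + 1] into [(a + 1) p], which is bounded below because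
    [a p >= mu L]. *)
Lemma large_indep_failure_small :
  exp 1 * INR n / (INR a + 1) * exp (- (- ln (1 - p) / 2 * INR a)) <=
  exp (- (3 / 4 * eta * L)).
Proof.
destruct a_bounds as [A0 [A1 _]]. destruct lam_bounds as [E _].
destruct Lam_bounds as [La1 La2]. assert (Mu := mu_bounds). assert (Et := eta_bounds).
destruct ell_bounds as [El1 El2]. assert (x0 : 0 < x) by apply exp_pos.
fold Lam. rewrite Hn. fold x.
assert (E1 : exp (- (Lam / 2 * INR a)) <= / (x * p) * exp (- (eta * ell))).
{ rewrite <- exp_ell, <- exp_Ropp, <- exp_plus. apply exp_le_compat.
  assert (Lam / 2 * ((1 + eta) * lam) <= Lam / 2 * INR a) by (apply Rmult_le_compat_l; lra).
  replace (Lam / 2 * ((1 + eta) * lam)) with ((1 + eta) / 2 * (lam * Lam)) in H by field.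
  rewrite E in H. lra. }
assert (E2 : exp (- (eta * ell)) <= exp (- (3 / 4 * eta * L))).
{ apply exp_le_compat.
  assert (eta * (3 / 4 * L) <= eta * ell) by (apply Rmult_le_compat_l; lra). lra. }
assert (xp : 0 < x * p) by (apply Rmult_lt_0_compat; lra).
assert (e3 := exp_le_3). assert (e0 := exp_pos 1).
assert (E0 := exp_pos (- (eta * ell))).
assert (ex : 0 <= exp 1 * x / (INR a + 1))
  by (apply Rle_mult_inv_pos; [apply Rmult_le_pos | ]; lra).
apply Rle_trans with (exp 1 * x / (INR a + 1) * (/ (x * p) * exp (- (eta * ell)))).
{ apply Rmult_le_compat_l; lra. }
rewrite <- Rmult_assoc. apply Rle_trans with (1 * exp (- (eta * ell))); [ | lra].
apply Rmult_le_compat_r; [lra | ].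
replace (exp 1 * x / (INR a + 1) * / (x * p)) with (exp 1 / ((INR a + 1) * p))
  by (field; repeat split; lra).
assert (ap : mu * L <= INR a * p).
{ apply Rle_trans with (lam * p); [ | apply Rmult_le_compat_r; lra].
  apply Rmult_le_reg_r with Lam; [lra | ].
  replace (lam * p * Lam) with (2 * ell * p) by (rewrite <- E; ring).
  nra. }
assert (160 <= mu * L) by nra.
apply div_le; nra.
Qed.

(** The [8] in [D >= 8 m p] makes the inner exponent at most [3 m p - 4 m p = - m p <= - 2 L], which
    beats the factor [n]. *)
Lemma density_failure_small : exp (INR n * exp (3 * p * INR m - INR D / 2)) - 1 <= 2 * exp (- L).
Proof.
destruct m_bounds as [_ [M1 [_ [M2 M0]]]]. assert (U := u_ge1). assert (Xx := x_eq_u4).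
destruct L_powers_bounds as [P1 [P2 [P3 P4]]].
assert (x0 : 0 < x) by apply exp_pos.
assert (B : 2 * L <= INR m * p).
{ apply Rmult_le_reg_r with (L ^ 2 * u); [nra | ].
  replace (INR m * p * (L ^ 2 * u)) with (INR m * L ^ 2 * (p * u)) by ring.
  apply Rle_trans with (x * 1); [ | apply Rmult_le_compat; lra].
  rewrite Xx, Rmult_1_r. replace (u ^ 4) with (u ^ 2 * u * u) by ring.
  rewrite <- Rmult_assoc. apply Rmult_le_compat_r; [lra | ].
  assert (1 <= u ^ 2) by nra.
  assert (L ^ 3 <= L ^ 5).
  { replace (L ^ 5) with (L ^ 2 * L ^ 3) by ring.
    assert (0 < L ^ 3) by (apply pow_lt; lra). nra. }
  replace (2 * L * L ^ 2) with (2 * L ^ 3) by ring.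
  assert (0 < L ^ 3) by (apply pow_lt; lra). nra. }
assert (E1 : exp (3 * p * INR m - INR D / 2) <= exp (- (2 * L))).
{ apply exp_le_compat. nra. }
assert (E2 : INR n * exp (3 * p * INR m - INR D / 2) <= exp (- L)).
{ rewrite Hn. apply Rle_trans with (exp L * exp (- (2 * L))).
  - apply Rmult_le_compat_l; [left; apply exp_pos | exact E1].
  - rewrite <- exp_plus. right. f_equal. ring. }
set (z := exp (- L)) in *.
assert (z0 : 0 < z) by apply exp_pos.
assert (z1 : z <= 1 / 2).
{ unfold z. rewrite exp_Ropp. apply Rle_trans with (/ 2); [ | lra].
  apply Rinv_le_contravar; [lra | ]. generalize (exp_ineq1_le L). lra. }
apply Rle_trans with (exp z - 1); [apply exp_le_compat in E2; lra | ].
assert (H : exp z <= / (1 - z)).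
{ rewrite <- (Rinv_inv (exp z)). rewrite <- exp_Ropp. apply Rinv_le_contravar; [lra | ].
  generalize (exp_ineq1_le (- z)). lra. }
apply Rle_trans with (/ (1 - z) - 1); [lra | ].
replace (/ (1 - z) - 1) with (z / (1 - z)) by (field; lra).
apply div_le; [lra | nra].
Qed.

End Asymptotics.

(** * Parameters for all large [n] *)

Definition eventually_large (P : R -> Prop) : Prop :=
  exists L0 : R, forall L, L0 <= L -> P L.

Lemma eventually_large_and (P Q : R -> Prop) :
  eventually_large P -> eventually_large Q -> eventually_large (fun L => P L /\ Q L).
Proof.
intros [a Ha] [b Hb]. exists (Rmax a b). intros L HL. split.
- apply Ha. eapply Rle_trans; [apply Rmax_l | exact HL].
- apply Hb. eapply Rle_trans; [apply Rmax_r | exact HL].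
Qed.

Lemma eventually_large_ge (c y : R) : 0 < c -> eventually_large (fun L => y <= c * L).
Proof.
intros Hc. exists (y / c). intros L HL.
apply Rmult_le_compat_l with (r := c) in HL; [ | lra].
replace (c * (y / c)) with y in HL by (field; lra). exact HL.
Qed.

Lemma asymptotic_parameters (eps delta kappa : R) :
  0 < eps < 1 -> 0 < delta <= 1 -> 0 < kappa ->
  exists N : nat, forall (n : nat) (p : R), (N <= n)%nat -> 0 < p ->
  Rpower (INR n) (-1/4) * Rpower (ln (INR n)) (9/4) <= p < eps ->
  exists (k a m D l0 : nat) (X rho : R),
  (2 <= INR n /\ 3 <= INR k /\ 100 <= INR a /\ INR k <= INR m /\ 0 < INR l0 /\
   2 * INR a * INR k ^ 2 < INR m) /\
  2 * INR a * (INR n / INR k + INR D + INR a + 1) <= (2 + delta) * INR n /\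
  (0 < X <= 1 /\ 0 <= rho <= 1 /\
   (forall l : nat, 2 <= INR l <= INR k -> INR l <= INR l0 ->
      overlap_base p (INR k) (INR m) (INR l) <= X) /\
   (forall l : nat, 2 <= INR l <= INR k ->
      overlap_base p (INR k) (INR m) (INR l) <= rho)) /\
  exp (2 * INR n * ln (INR n) - / (8 * (INR l0 * X ^ 2 + INR k * rho ^ l0))) <= kappa /\
  exp 1 * INR n / (INR a + 1) * exp (- (- ln (1 - p) / 2 * INR a)) <= kappa /\
  exp (INR n * exp (3 * p * INR m - INR D / 2)) - 1 <= kappa.
Proof.
intros He Hd Hk.
set (eta := delta / 40). set (mu := 1 - eps).
assert (eta0 : 0 < eta) by (unfold eta; lra).
assert (mu0 : 0 < mu) by (unfold mu; lra).
destruct (nat_ceil (6 / eta)) as [l0 Hl0]; [apply Rle_mult_inv_pos; lra | ].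
assert (Hl : 6 <= INR l0 * eta).
{ destruct Hl0 as [H _]. apply Rmult_le_compat_r with (r := eta) in H; [ | lra].
  replace (6 / eta * eta) with 6 in H by (field; lra). exact H. }
set (G := 3 * exp (INR l0 / (2 * mu))).
set (A := 8 * (INR l0 + 1) * G ^ 2).
(* The factors [1 *] and [L ^ 0] put each condition into the shape of [exp_dominates_power] or
   [eventually_large_ge]. The [33] yields the strict inequality with [32], and the last two
   conditions bring the failure probabilities below [kappa]. *)
assert (EV : eventually_large (fun L =>
  (4 <= L /\ 33 * L ^ 5 <= exp (1 / 4 * L) /\ 4 * G * L ^ 4 <= exp (1 / 4 * L) /\
   12 * L ^ 4 <= exp (1 / 8 * L) /\ 24 * L ^ 3 <= exp (eta / 4 * L)) /\
  (48 * A <= 1 * L /\ (512 / delta) ^ 2 <= 1 * L /\ 4 <= eta * mu * L /\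
   (256 / delta) * L ^ 2 <= exp (1 / 4 * L)) /\
  2 / kappa * L ^ 0 <= exp (1 * L) /\ / kappa * L ^ 0 <= exp (3 / 4 * eta * L))).
{ repeat apply eventually_large_and;
    try (apply exp_dominates_power; lra);
    try (apply eventually_large_ge; try lra; apply Rmult_lt_0_compat; lra).
  exists 4. now intros. }
destruct EV as [L0 HL0].
destruct (nat_ceil (exp L0)) as [N [HN _]]; [left; apply exp_pos | ].
exists N. intros n p HnN p0 [Hp1 Hp2].
set (L := ln (INR n)).
assert (xL0 := exp_pos L0).
assert (HNn : INR N <= INR n) by now apply le_INR.
assert (Hn : INR n = exp L) by (unfold L; rewrite exp_ln; lra).
assert (HL : L0 <= L).
{ destruct (Rle_or_lt L0 L) as [H | H]; [easy | ]. apply exp_increasing in H. lra. }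
destruct (HL0 L HL) as [[L4 [g1 [g2 [g3 g4]]]] [[g5 [g6 [g7 g8]]] [h1 h2]]].
unfold Rpower in Hp1. fold L in Hp1.
set (u := exp (L / 4)). set (s := sqrt L).
replace (1 / 4 * L) with (L / 4) in g1, g2, g8 by field. fold u in g1, g2, g8.
assert (L5 : 0 < L ^ 5) by (apply pow_lt; lra).
assert (lnL : 0 <= ln L).
{ rewrite <- ln_1. destruct (Rle_lt_or_eq_dec 1 L) as [H | <-]; [lra | | lra].
  left. apply ln_increasing; lra. }
assert (u0 : 0 < u) by apply exp_pos.
assert (Hpu : 1 <= p * u).
{ apply Rle_trans with (exp (-1 / 4 * L) * exp (9 / 4 * ln L) * u);
    [ | apply Rmult_le_compat_r; lra].
  unfold u. rewrite <- !exp_plus. rewrite <- exp_0 at 1. apply exp_le_compat. lra. }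
(* The fourth power of the lower bound on [p] is [L^9 / n]. *)
assert (Hp4 : L ^ 9 <= p ^ 4 * exp L).
{ apply Rle_trans with ((exp (-1 / 4 * L) * exp (9 / 4 * ln L)) ^ 4 * exp L).
  - rewrite <- exp_plus, exp_pow_INR, <- exp_plus.
    replace (INR 4 * (-1 / 4 * L + 9 / 4 * ln L) + L) with (INR 9 * ln L)
      by (simpl; field).
    rewrite <- exp_pow_INR, exp_ln by lra. lra.
  - apply Rmult_le_compat_r; [left; apply exp_pos | ].
    apply pow_incr. split; [ | exact Hp1].
    apply Rmult_le_pos; left; apply exp_pos. }
assert (g1' : 32 * L ^ 5 < u) by lra.
assert (g5' : 48 * A <= L) by lra.
assert (g6' : 512 <= delta * s).
{ assert (H : 512 / delta <= s).
  { unfold s. rewrite <- (sqrt_pow2 (512 / delta)).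
    - apply sqrt_le_1; [apply pow2_ge_0 | lra | lra].
    - apply Rle_mult_inv_pos; lra. }
  apply Rmult_le_compat_l with (r := delta) in H; [ | lra].
  replace (delta * (512 / delta)) with 512 in H by (field; lra). exact H. }
assert (g7' : 4 <= eta * (mu * L)) by (rewrite <- Rmult_assoc; exact g7).
assert (g8' : 256 * L ^ 2 <= delta * u).
{ apply Rmult_le_compat_l with (r := delta) in g8; [ | lra].
  replace (delta * (256 / delta * L ^ 2)) with (256 * L ^ 2) in g8 by (field; lra). exact g8. }
assert (Hp : 0 < p < eps) by lra.
assert (Hu : u = exp (L / 4)) by reflexivity.
assert (Hs : s = sqrt L) by reflexivity.
set (lam := 2 * (L + ln p) / (- ln (1 - p))).
assert (lam0 : 0 <= lam).
{ assert (H : lam * - ln (1 - p) = 2 * (L + ln p) /\ lam * p <= 2 * L /\ 4 <= eta * lam)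
    by (eapply lam_bounds with (L := L) (delta := delta); eassumption).
  destruct H as [_ [_ H]]. nra. }
assert (s0 : 0 < s) by (apply sqrt_lt_R0; lra).
destruct (nat_floor ((1 - eta) * lam)) as [k HHk].
{ apply Rmult_le_pos; [unfold eta; lra | exact lam0]. }
destruct (nat_ceil ((1 + eta) * lam)) as [a HHa]; [apply Rmult_le_pos; lra | ].
destruct (nat_ceil (exp L / (L * s))) as [m HHm].
{ apply Rle_mult_inv_pos; [left; apply exp_pos | apply Rmult_lt_0_compat; lra]. }
destruct (nat_ceil (8 * INR m * p)) as [D HHD].
{ apply Rmult_le_pos; [ | lra]. generalize (pos_INR m). lra. }
exists k, a, m, D, l0, (G * INR k ^ 2 / INR m), (exp (- (eta / 2 * L))).
repeat match goal with |- _ /\ _ => split end.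
- rewrite Hn. apply Rle_trans with (1 + L); [lra | ]. generalize (exp_ineq1_le L). lra.
- eapply k_bounds with (L := L) (delta := delta); eassumption.
- eapply a_bounds with (L := L) (delta := delta); eassumption.
- eapply k_le_m with (L := L) (delta := delta); eassumption.
- destruct (Rle_lt_or_eq_dec 0 (INR l0) (pos_INR l0)) as [|F]; [easy | ].
  rewrite <- F in Hl. lra.
- eapply two_a_k_sqr_lt_m with (L := L) (delta := delta); eassumption.
- eapply color_count_le with (L := L) (delta := delta); eassumption.
- eapply X_bounds with (L := L) (delta := delta); eassumption.
- eapply X_bounds with (L := L) (delta := delta); eassumption.
- eapply rho_bounds with (L := L) (delta := delta); eassumption.
- eapply rho_bounds with (L := L) (delta := delta); eassumption.
- intros l Hl1 Hl2. eapply overlap_base_small with (L := L) (delta := delta); eassumption.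
- intros l Hl1. eapply overlap_base_large with (L := L) (delta := delta); eassumption.
- apply Rle_trans with (exp (- L));
    [eapply transversal_failure_small with (L := L) (delta := delta); eassumption | ].
  rewrite exp_Ropp. rewrite <- (Rinv_inv kappa).
  apply Rinv_le_contravar; [now apply Rinv_0_lt_compat | ].
  rewrite Rmult_1_l in h1. simpl in h1.
  assert (0 < / kappa) by now apply Rinv_0_lt_compat. unfold Rdiv in h1. lra.
- apply Rle_trans with (exp (- (3 / 4 * eta * L)));
    [eapply large_indep_failure_small with (L := L) (delta := delta); eassumption | ].
  rewrite exp_Ropp. rewrite <- (Rinv_inv kappa).
  apply Rinv_le_contravar; [now apply Rinv_0_lt_compat | ].
  simpl in h2. lra.
- apply Rle_trans with (2 * exp (- L));
    [eapply density_failure_small with (L := L) (delta := delta); eassumption | ].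
  rewrite exp_Ropp. apply div_le; [apply exp_pos | ].
  rewrite Rmult_1_l in h1. simpl in h1.
  apply Rmult_le_compat_l with (r := kappa) in h1; [ | lra].
  replace (kappa * (2 / kappa * 1)) with 2 in h1 by (field; lra). lra.
Qed.

Local Close Scope R_scope.

(** * Expectations over random sets and Janson's inequality *)

From mathcomp Require Import all_boot all_order all_algebra.
From mathcomp Require Import ring lra zify Rstruct.
Require Import Defs.

Set Implicit Arguments.
Unset Strict Implicit.
Unset Printing Implicit Defensive.
Import Order.TTheory GRing.Theory Num.Theory.
Local Open Scope ring_scope.

(* Expectation of [f E] when each element of [s] is put into [E] independently with
   probability [p] ([s] duplicate-free). *)
Fixpoint Ex (R : realFieldType) (T : finType) (p : R) (s : seq T)
    (f : {set T} -> R) : R :=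
  if s is e :: s' then
    p * Ex p s' (fun E => f (e |: E)) + (1 - p) * Ex p s' f
  else f set0.

Lemma Ex_le_in (R : realFieldType) (T : finType) (p : R) (s : seq T) f g :
  0 <= p <= 1 -> (forall E : {set T}, {subset E <= s} -> f E <= g E) ->
  Ex p s f <= Ex p s g.
Proof.
move=> p01; elim: s f g => [|e s IH] f g fg /=.
  by apply: fg => x; rewrite inE.
have /andP[p0 p1] := p01; apply: lerD; apply: ler_wpM2l; rewrite ?subr_ge0 //.
- apply: IH => E Es; apply: fg => x; rewrite !inE => /orP[->//|/Es->].
  by rewrite orbT.
- by apply: IH => E Es; apply: fg => x /Es; rewrite inE orbC => ->.
Qed.

Lemma Ex_le (R : realFieldType) (T : finType) (p : R) (s : seq T) f g :
  0 <= p <= 1 -> (forall E : {set T}, f E <= g E) -> Ex p s f <= Ex p s g.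
Proof. by move=> p01 fg; apply: Ex_le_in. Qed.

Lemma eq_Ex_in (R : realFieldType) (T : finType) (p : R) (s : seq T) f g :
  (forall E : {set T}, {subset E <= s} -> f E = g E) -> Ex p s f = Ex p s g.
Proof.
elim: s f g => [|e s IH] f g fg /=; first by apply: fg => x; rewrite inE.
congr (_ * _ + _ * _); apply: IH => E Es; apply: fg => x.
  by rewrite !inE => /orP[->//|/Es->]; rewrite orbT.
by move=> /Es; rewrite inE orbC => ->.
Qed.

Lemma eq_Ex (R : realFieldType) (T : finType) (p : R) (s : seq T) f g :
  f =1 g -> Ex p s f = Ex p s g.
Proof. by move=> fg; apply: eq_Ex_in. Qed.

Lemma Ex_const (R : realFieldType) (T : finType) (p : R) (s : seq T) (c : R) :
  Ex p s (fun _ => c) = c.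
Proof. by elim: s => //= e s ->; ring. Qed.

Lemma Ex_ge0 (R : realFieldType) (T : finType) (p : R) (s : seq T) f :
  0 <= p <= 1 -> (forall E : {set T}, 0 <= f E) -> 0 <= Ex p s f.
Proof. by move=> p01 f0; rewrite -{1}(Ex_const p s 0); apply: Ex_le. Qed.

Lemma Ex_add (R : realFieldType) (T : finType) (p : R) (s : seq T) f g :
  Ex p s (fun E : {set T} => f E + g E) = Ex p s f + Ex p s g.
Proof. by elim: s f g => //= e s IH f g; rewrite !IH; ring. Qed.

Lemma Ex_scale (R : realFieldType) (T : finType) (p : R) (s : seq T) c f :
  Ex p s (fun E : {set T} => c * f E) = c * Ex p s f.
Proof. by elim: s f => //= e s IH f; rewrite !IH; ring. Qed.

Lemma Ex_sum (R : realFieldType) (T : finType) (p : R) (s : seq T)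
    (I : Type) (r : seq I) (P : pred I) (f : I -> {set T} -> R) :
  Ex p s (fun E => \sum_(i <- r | P i) f i E) = \sum_(i <- r | P i) Ex p s (f i).
Proof.
elim: r => [|i r IH].
  by rewrite big_nil -[RHS](Ex_const p s); apply: eq_Ex => E; rewrite big_nil.
rewrite big_cons -IH; case: ifP => Pi.
  by rewrite -Ex_add; apply: eq_Ex => E; rewrite big_cons Pi.
by apply: eq_Ex => E; rewrite big_cons Pi.
Qed.

(** Conditioned on avoiding [Q], the random set is distributed as [E :\: Q]. This replaces
    conditional expectations, and also independence: a function of the elements outside [Q] does not
    see the removal. *)
Lemma Ex_avoid (R : realFieldType) (T : finType) (p : R) (s : seq T)
    (Q : {set T}) f :
  Ex p s (fun E => (Q :&: E == set0)%:R * f E) =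
  (1 - p) ^+ count (mem Q) s * Ex p s (fun E => f (E :\: Q)).
Proof.
elim: s f => [|e s IH] f /=; first by rewrite setI0 eqxx set0D !mul1r.
have [eQ|eQ] := boolP (e \in Q).
  have -> : Ex p s (fun E => (Q :&: (e |: E) == set0)%:R * f (e |: E)) = 0.
    rewrite -[RHS](Ex_const p s); apply: eq_Ex => E.
    suff /negPf-> : Q :&: (e |: E) != set0 by rewrite mul0r.
    by apply/set0Pn; exists e; rewrite !inE eqxx eQ.
  rewrite IH /= add1n exprS.
  have -> : Ex p s (fun E => f ((e |: E) :\: Q)) = Ex p s (fun E => f (E :\: Q)).
    apply: eq_Ex => E; congr (f _); apply/setP => x.
    by rewrite !inE; case: eqP => [->|//]; rewrite eQ.
  by ring.
have -> : Ex p s (fun E => (Q :&: (e |: E) == set0)%:R * f (e |: E)) =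
          Ex p s (fun E => (Q :&: E == set0)%:R * f (e |: E)).
  apply: eq_Ex => E; congr ((_ == _)%:R * _); apply/setP => x.
  by rewrite !inE; case: eqP => [->|//]; rewrite (negPf eQ).
rewrite add0n (IH f); have /= -> := IH (fun E => f (e |: E)).
have -> : Ex p s (fun E => f ((e |: E) :\: Q)) = Ex p s (fun E => f (e |: (E :\: Q))).
  apply: eq_Ex => E; congr (f _); apply/setP => x.
  by rewrite !inE; case: eqP => [->|//]; rewrite eQ.
by ring.
Qed.

Lemma Ex_avoid1 (R : realFieldType) (T : finType) (p : R) (s : seq T)
    (Q : {set T}) :
  Ex p s (fun E => (Q :&: E == set0)%:R) = (1 - p) ^+ count (mem Q) s.
Proof.
have := Ex_avoid p s Q (fun _ => 1); rewrite Ex_const mulr1 => <-.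
by apply: eq_Ex => E; rewrite mulr1.
Qed.

Lemma Ex_expr_card (R : realFieldType) (T : finType) (p x : R) (s : seq T)
    (A : {set T}) :
  uniq s -> Ex p s (fun E => x ^+ #|E :&: A|) = (1 + p * (x - 1)) ^+ count (mem A) s.
Proof.
elim: s => [|e s IH] /=; first by rewrite set0I cards0.
case/andP=> es us; rewrite IH //.
have -> : Ex p s (fun E => x ^+ #|(e |: E) :&: A|) =
          x ^+ (e \in A) * Ex p s (fun E => x ^+ #|E :&: A|).
  rewrite -Ex_scale; apply: eq_Ex_in => E Es; rewrite -exprD; congr (_ ^+ _).
  rewrite setIUl; have eE : e \notin E by apply: contra es; apply: Es.
  have [eA|eA] := boolP (e \in A).
    have -> : [set e] :&: A = [set e] by apply/setIidPl; rewrite sub1set.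
    by rewrite cardsU1 inE (negPf eE).
  have -> : [set e] :&: A = set0.
    apply/eqP/set0Pn => -[y]; rewrite !inE => /andP[/eqP->].
    by rewrite (negPf eA).
  by rewrite set0U.
rewrite IH //; case: (e \in A) => /=; rewrite ?add1n ?add0n ?exprS ?expr1; ring.
Qed.

Lemma Ex_union (R : realFieldType) (T : finType) (p : R) (s : seq T)
    (I : finType) (P : pred I) (A : {set T} -> bool) (B : I -> {set T} -> bool) :
  0 <= p <= 1 ->
  (forall E : {set T}, {subset E <= s} -> A E -> exists2 i, P i & B i E) ->
  Ex p s (fun E => (A E)%:R) <= \sum_(i | P i) Ex p s (fun E => (B i E)%:R).
Proof.
move=> p01 AB; rewrite -Ex_sum; apply: Ex_le_in => // E Es.
have [/(AB _ Es) [i Pi Bi]|_] := boolP (A E); last by apply: sumr_ge0 => i _; apply: ler0n.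
by rewrite (bigD1 i) //= Bi lerDl; apply: sumr_ge0 => j _; apply: ler0n.
Qed.

(** Weierstrass's product inequality, playing the role of a union bound with weights. *)
Lemma prod_one_sub_ge (R : realFieldType) (I : Type) (r : seq I) (x : I -> R) :
  (forall i, 0 <= x i <= 1) ->
  1 - \sum_(i <- r) x i <= \prod_(i <- r) (1 - x i).
Proof.
move=> x01; elim: r => [|i r IH]; first by rewrite !big_nil subr0.
rewrite !big_cons.
have P1 : \prod_(i <- r) (1 - x i) <= 1.
  by apply: prodr_ile1 => j _; have := x01 j; lra.
have /andP[x0 x1] := x01 i.
have : 0 <= x i * (1 - \prod_(i <- r) (1 - x i)) by apply: mulr_ge0 => //; lra.
nra.
Qed.

(* [th] plays the role of a sampling rate for the family [F]: with [th = 1] this is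
   Janson's inequality proper, and optimising over [th] gives its extended form.
   Given an edge set avoiding [Q], the factors of [Q'] disjoint from [Q] are
   independent of [Q], and conditioning on a decreasing event can only lower the
   expectation of the increasing function [G C]. *)
Lemma janson_prod (R : realFieldType) (T : finType) (p th r : R) (s : seq T)
    (F : seq {set T}) :
  0 <= p <= 1 -> 0 <= th <= 1 -> 0 <= r ->
  (forall Q, Q \in F ->
     r <= (1 - p) ^+ count (mem Q) s -
       th * \sum_(Q' <- F | Q :&: Q' != set0) (1 - p) ^+ count (mem (Q :|: Q')) s) ->
  Ex p s (fun E => \prod_(Q <- F) (1 - th * (Q :&: E == set0)%:R)) <=
  (1 - th * r) ^+ size F.
Proof.
move=> p01 th01 r0 hF.
pose b (Q E : {set T}) : R := (Q :&: E == set0)%:R.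
pose G (F' : seq {set T}) E := \prod_(Q <- F') (1 - th * b Q E).
have b01 Q E : 0 <= b Q E <= 1 by rewrite /b; case: eqP => _; rewrite ?lexx ?ler01.
have thb Q E : 0 <= th * b Q E <= 1 by have := b01 Q E; have := th01; nra.
have G01 F' E : 0 <= G F' E <= 1.
  apply/andP; split; first by apply: prodr_ge0 => Q _; have := thb Q E; lra.
  by apply: prodr_ile1 => Q _; have := thb Q E; lra.
have q01 m : 0 <= (1 - p) ^+ m <= 1.
  by rewrite exprn_ge0 ?exprn_ile1 //; have := p01; lra.
have p0 : 0 <= 1 - p by have := p01; lra.
(* The induction runs over suffixes [F'] of a fixed [F], so that the correlation hypothesis can keep
   summing over all of [F]. *)
suff H F' pre : F = pre ++ F' ->
   Ex p s (G F') <= (1 - th * r) ^+ size F' by apply: (H _ [::]).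
elim: F' pre => [|Q F' IH] pre defF.
  rewrite -[leRHS](Ex_const p s); apply: Ex_le => // E.
  by rewrite /G big_nil.
have QF : Q \in F by rewrite defF mem_cat mem_head orbT.
have {}IH : Ex p s (G F') <= (1 - th * r) ^+ size F'.
  by apply: (IH (rcons pre Q)); rewrite cat_rcons.
pose C := [seq Q' <- F' | Q :&: Q' == set0].
pose D := [seq Q' <- F' | Q :&: Q' != set0].
have GCD E : G F' E = G C E * G D E.
  by rewrite /G /C /D !big_filter (bigID (fun Q' => Q :&: Q' == set0)).
have rQ := hF _ QF; set rr := _ - _ in rQ.
have EC0 : 0 <= Ex p s (G C) by apply: Ex_ge0 => // E; case/andP: (G01 C E).
(* The factors in [D], which may depend on [Q], are expanded by [prod_one_sub_ge]. The main term
   factors exactly by [Ex_avoid], and the correction terms are bounded by the sum inside [rr]. *)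
have step : rr * Ex p s (G C) <= Ex p s (fun E => b Q E * G F' E).
  apply: le_trans (_ : Ex p s (fun E => b Q E * G C E
       + - th * (\sum_(Q' <- D) b (Q :|: Q') E * G C E)) <= _); last first.
    apply: Ex_le => // E; rewrite GCD.
    have h : 1 - \sum_(Q' <- D) th * b Q' E <= G D E by apply: prod_one_sub_ge.
    have bU Q' : b (Q :|: Q') E = b Q E * b Q' E.
      by rewrite /b setIUl setU_eq0; do 2!case: (_ == _); rewrite /= ?mulr1 ?mulr0.
    have -> : \sum_(Q' <- D) b (Q :|: Q') E * G C E =
              b Q E * G C E * \sum_(Q' <- D) b Q' E.
      by rewrite mulr_sumr; apply: eq_bigr => Q' _; rewrite bU; ring.
    rewrite -mulr_sumr in h.
    have : 0 <= b Q E * G C E by apply: mulr_ge0; [case/andP: (b01 Q E)|case/andP: (G01 C E)].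
    nra.
  rewrite Ex_add Ex_scale Ex_sum.
  have -> : Ex p s (fun E => b Q E * G C E) = (1 - p) ^+ count (mem Q) s * Ex p s (G C).
    rewrite Ex_avoid; congr (_ * _); apply: eq_Ex => E.
    rewrite /G; apply: eq_big_seq => Q'; rewrite mem_filter => /andP[/eqP QQ' _].
    congr (1 - th * _%:R); congr (_ == _ : nat).
    apply/setP => x; move/setP/(_ x): QQ'; rewrite !inE.
    by case: (x \in Q); case: (x \in Q').
  have hs : \sum_(Q' <- D) Ex p s (fun E => b (Q :|: Q') E * G C E) <=
     (\sum_(Q' <- F | Q :&: Q' != set0) (1 - p) ^+ count (mem (Q :|: Q')) s) * Ex p s (G C).
    rewrite mulr_suml.
    apply: le_trans (_ : \sum_(Q' <- D) (1 - p) ^+ count (mem (Q :|: Q')) s * Ex p s (G C) <= _).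
      apply: ler_sum => Q' _; rewrite Ex_avoid ler_wpM2l //;
        first by case/andP: (q01 (count (mem (Q :|: Q')) s)).
      apply: Ex_le => // E; apply: ler_prod => Q'' _; apply/andP; split.
        by have := thb Q'' (E :\: (Q :|: Q')); rewrite /b; lra.
      have : b Q'' E <= b Q'' (E :\: (Q :|: Q')).
        rewrite /b; case: (Q'' :&: E =P set0) => [h|_]; last exact: ler0n.
        by rewrite -subset0 -h setIS // subsetDl.
      by rewrite /b; have := th01; nra.
    rewrite big_filter defF big_cat big_cons /=.
    have EQ0 Q' : 0 <= (1 - p) ^+ count (mem (Q :|: Q')) s * Ex p s (G C).
      by apply: mulr_ge0 => //; case/andP: (q01 (count (mem (Q :|: Q')) s)).
    have S0 : 0 <= \sum_(Q' <- pre | Q :&: Q' != set0)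
        (1 - p) ^+ count (mem (Q :|: Q')) s * Ex p s (G C).
      by apply: sumr_ge0.
    by case: ifP => _; have := EQ0 Q; lra.
  have th0 : 0 <= th by case/andP: th01.
  by have := ler_wpM2l th0 hs; rewrite /rr; lra.
(* The bound [step] concerns [G C] whereas the recursion concerns [G F']; dropping the factors of
   [D] only increases the product. *)
have EFC : Ex p s (G F') <= Ex p s (G C).
  by apply: Ex_le => // E; rewrite GCD; have := G01 C E; have := G01 D E; nra.
have EF0 : 0 <= Ex p s (G F') by apply: Ex_ge0 => // E; case/andP: (G01 F' E).
have -> : Ex p s (G (Q :: F')) = Ex p s (G F') + - th * Ex p s (fun E => b Q E * G F' E).
  rewrite -Ex_scale -Ex_add; apply: eq_Ex => E; rewrite /G big_cons; ring.
have r1 : r <= 1.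
  apply: le_trans rQ _; rewrite /rr lerBlDr.
  have : 0 <= \sum_(Q' <- F | Q :&: Q' != set0) (1 - p) ^+ count (mem (Q :|: Q')) s.
    by apply: sumr_ge0 => Q' _; case/andP: (q01 (count (mem (Q :|: Q')) s)).
  have := q01 (count (mem Q) s); have := th01; nra.
rewrite /= exprS.
apply: le_trans (_ : (1 - th * r) * Ex p s (G F') <= _); last first.
  by apply: ler_wpM2l => //; have := th01; nra.
have : r * Ex p s (G F') <= Ex p s (fun E => b Q E * G F' E).
  by apply: le_trans step; nra.
have := th01; nra.
Qed.

(** * Independent sets in the random graph *)

Definition pairs n (S : {set 'I_n}) : {set 'I_n * 'I_n} :=
  [set x | [&& x.1 \in S, x.2 \in S & (x.1 < x.2)%N]].

Definition indep n (E : {set 'I_n * 'I_n}) (S : {set 'I_n}) : bool :=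
  pairs S :&: E == set0.

Definition slots n : seq ('I_n * 'I_n) := enum (pairs [set: 'I_n]).

Lemma pairsI n (S S' : {set 'I_n}) : pairs S :&: pairs S' = pairs (S :&: S').
Proof.
apply/setP => x; rewrite !inE.
by case: (x.1 \in S); case: (x.2 \in S); case: (x.1 \in S'); case: (x.2 \in S');
  rewrite /= ?andbb ?andbF.
Qed.

Lemma double_half_mul_pred (m : nat) : ((m * m.-1)./2.*2 = m * m.-1)%N.
Proof.
by rewrite -[RHS]odd_double_half oddM; case: m => //= m; rewrite andNb.
Qed.

(** The square of [S] splits into the increasing pairs, their mirror images and the diagonal. *)
Lemma card_pairs n (S : {set 'I_n}) : #|pairs S| = 'C(#|S|, 2).
Proof.
pose rp := [set x : 'I_n * 'I_n | (x.2, x.1) \in pairs S].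
have crp : #|rp| = #|pairs S|.
  have sK : involutive (fun x : 'I_n * 'I_n => (x.2, x.1)) by case.
  by rewrite -(card_imset (mem (pairs S)) (inv_inj sK)); apply: eq_card => x;
     rewrite inE -[in RHS](sK x) (mem_imset _ _ (inv_inj sK)).
have cd : #|[set x : 'I_n * 'I_n | (x.1 \in S) && (x.2 == x.1)]| = #|S|.
  have dI : injective (fun u : 'I_n => (u, u)) by move=> u v [].
  rewrite -(card_imset (mem S) dI); apply: eq_card => -[u v].
  rewrite inE /=; apply/andP/imsetP => [[uS /eqP->]|[w wS [-> ->]]]; first by exists u.
  by rewrite eqxx.
have : (#|S| * #|S| = #|pairs S| + #|pairs S| + #|S|)%N.
  rewrite -cardsX -[in X in (_ + X + _)%N]crp -[in X in (_ + X)%N]cd.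
  have e1 : pairs S :&: rp = set0.
    apply/setP => x; rewrite !inE /=.
    by case: ltngtP => _; rewrite ?andbF.
  have e2 : (pairs S :|: rp) :&: [set x | (x.1 \in S) && (x.2 == x.1)] = set0.
    apply/setP => x; rewrite !inE /=; case: (x.2 =P x.1) => [->|_]; rewrite ?andbF //.
    by rewrite ltnn !andbF.
  rewrite -(cardsUI (pairs S)) e1 cards0 addn0 -cardsUI e2 cards0 addn0.
  apply: eq_card => -[u v]; rewrite !inE /=.
  have [->|] := eqVneq v u; first by rewrite ltnn !andbF; case: (u \in S).
  rewrite -val_eqE /=; case: (u \in S); case: (v \in S) => //=; rewrite ?orbF //.
  by case: ltngtP.
move=> h; have e : (#|S| * #|S|.-1 = #|pairs S|.*2)%N.
  by move: h; case: #|S| => [|m] /=; rewrite -addnn; nia.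
by rewrite bin2 e doubleK.
Qed.

Lemma pairs_subT n (S : {set 'I_n}) : pairs S \subset pairs [set: 'I_n].
Proof. by apply/subsetP => x; rewrite !inE => /and3P[_ _ ->]. Qed.

Lemma count_slots n (Q : {set 'I_n * 'I_n}) :
  Q \subset pairs [set: 'I_n] -> count (mem Q) (slots n) = #|Q|.
Proof.
move=> sQ; rewrite -size_filter /slots cardE; apply: perm_size.
apply: uniq_perm => [||x]; [exact/filter_uniq/enum_uniq|exact: enum_uniq|].
rewrite mem_filter !mem_enum /=.
by apply/andb_idr => /(subsetP sQ).
Qed.

Lemma size_slots n : size (slots n) = 'C(n, 2).
Proof. by rewrite /slots -cardE card_pairs cardsT card_ord. Qed.

Lemma edge_ok_sub n (E : {set 'I_n * 'I_n}) :
  edge_ok E = (E \subset pairs [set: 'I_n]).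
Proof.
apply/forall_inP/subsetP => h x /h; first by rewrite !inE.
by rewrite !inE.
Qed.

Lemma edge_ok_slots n (E : {set 'I_n * 'I_n}) :
  {subset E <= slots n} -> edge_ok E.
Proof.
move=> h; rewrite edge_ok_sub; apply/subsetP => x /h.
by rewrite mem_enum.
Qed.

Lemma indepP n (E : {set 'I_n * 'I_n}) (S : {set 'I_n}) : edge_ok E ->
  reflect {in S &, forall u v, ~~ adj E u v} (indep E S).
Proof.
move=> /forall_inP ok; apply: (iffP eqP) => [h u v uS vS|h].
  apply/negP; case/orP => e; have /= l := ok _ e.
    by move/setP/(_ (u, v)): h; rewrite !inE e uS vS l.
  by move/setP/(_ (v, u)): h; rewrite !inE e uS vS l.
apply/setP => -[u v]; rewrite !inE /=; apply/negP => /andP[/and3P[uS vS _] e].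
by have := h _ _ uS vS; rewrite /adj e.
Qed.

(** Identifies the recursive expectation, convenient for induction, with the weighted sum that
    defines [gnp_prob]. *)
Lemma Ex_sum_weight (R : realFieldType) (T : finType) (p : R) (s : seq T) f :
  uniq s -> Ex p s f =
  \sum_(E : {set T} | E \subset s) p ^+ #|E| * (1 - p) ^+ (size s - #|E|) * f E.
Proof.
elim: s f => [|e s IH] f /=.
  move=> _; rewrite (big_pred1 set0) ?cards0 ?expr0 ?mul1r // => E.
  by rewrite /= -subset0; apply: eq_subset_r => x; rewrite inE.
case/andP=> es us; rewrite (bigID (fun E : {set T} => e \in E)) /=.
rewrite !IH // !mulr_sumr; congr (_ + _).
  rewrite [RHS](reindex_onto (fun E : {set T} => e |: E) (fun E => E :\ e)) /=; last first.
    by move=> E /andP[_ eE]; rewrite setD1K.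
  have cond E : (((e |: E \subset e :: s) && (e \in e |: E)) &&
      ((e |: E) :\ e == E)) = (E \subset s).
    rewrite !inE eqxx andbT /=; apply/andP/subsetP => [[/subsetP h /eqP h2] x xE|h].
      have := h x; rewrite !inE xE orbT => /(_ isT).
      by case: eqP => //= xe _; move: xE; rewrite -h2 xe !inE eqxx.
    have eE : e \notin E by apply: contra es; apply: h.
    split; last by rewrite setU1K.
    by apply/subsetP => x; rewrite !inE => /orP[->//|/h->]; rewrite orbT.
  rewrite [RHS](eq_bigl _ _ cond); apply: eq_bigr => E /subsetP sE.
  have eE : e \notin E by apply: contra es; apply: sE.
  by rewrite cardsU1 eE add1n subSS exprS; ring.
have cond (E : {set T}) : ((E \subset e :: s) && (e \notin E)) = (E \subset s).
  apply/andP/subsetP => [[/subsetP h eE] x xE|h].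
    have := h x xE; rewrite inE => /orP[/eqP xe|//].
    by move: eE; rewrite -xe xE.
  split; last by apply: contra es; apply: h.
  by apply/subsetP => x /h; rewrite inE orbC => ->.
rewrite [RHS](eq_bigl _ _ cond); apply: eq_bigr => E sE.
have cE : (#|E| <= size s)%N.
  by apply: leq_trans (card_size s); apply: subset_leq_card.
by rewrite subSn // exprS; ring.
Qed.

(** * Counting sets with prescribed intersections, and transversal sets *)

Lemma card_between (T : finType) (L W : {set T}) k : L \subset W ->
  (#|[set S : {set T} | [&& L \subset S, S \subset W & #|S| == k]]| <=
   'C(#|W| - #|L|, k - #|L|))%N.
Proof.
move=> LW; set A := [set S | _].
have inj : {in A &, injective (fun S : {set T} => S :\: L)}.
  move=> S S'; rewrite !inE => /and3P[LS _ _] /and3P[LS' _ _] /= h.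
  by rewrite -(setID S L) -(setID S' L) h (setIidPr LS) (setIidPr LS').
rewrite -(card_in_imset inj).
have cWL : #|W :\: L| = (#|W| - #|L|)%N by rewrite cardsD (setIidPr LW).
rewrite -cWL -cards_draws; apply: subset_leq_card; apply/subsetP => X /imsetP[S SA ->].
move: SA; rewrite !inE => /and3P[LS SW /eqP <-].
by rewrite setSD // cardsD (setIidPr LS) eqxx.
Qed.

Lemma card_inter_draws (T : finType) (S W : {set T}) k l : S \subset W ->
  (#|[set S' : {set T} | [&& S' \subset W, #|S'| == k & #|S :&: S'| == l]]| <=
   'C(#|S|, l) * 'C(#|W| - l, k - l))%N.
Proof.
move=> SW; set A := [set S' | _].
apply: (@leq_trans (\sum_(L in [set L : {set T} | L \subset S & #|L| == l])
   #|[set S' : {set T} | [&& L \subset S', S' \subset W & #|S'| == k]]|)).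
  have sA : A \subset \bigcup_(L in [set L : {set T} | L \subset S & #|L| == l])
     [set S' : {set T} | [&& L \subset S', S' \subset W & #|S'| == k]].
    apply/subsetP => S'; rewrite inE => /and3P[h1 h2 h3].
    by apply/bigcupP; exists (S :&: S'); rewrite !inE ?subsetIl ?h3 // subsetIr h1 h2.
  apply: leq_trans (subset_leq_card sA) _.
  elim/big_ind2: _ => [|x1 x2 y1 y2 h1 h2|//]; first by rewrite cards0.
  by apply: leq_trans (leq_add h1 h2); rewrite cardsU leq_subr.
rewrite -cards_draws -sum_nat_const; apply: leq_sum => L.
rewrite inE => /andP[LS /eqP <-].
by apply: card_between; apply: subset_trans LS SW.
Qed.

(** A partition is encoded by the fibres of a function; [inj_on] then describes the sets meeting
    each class at most once. *)
Definition inj_on (T U : finType) (f : {ffun T -> U}) (S : {set T}) : bool :=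
  [forall u in S, forall v in S, (f u == f v) ==> (u == v)].

Definition small_classes (T U : finType) (f : {ffun T -> U}) (a : nat) : bool :=
  [forall u, (#|[set v | f v == f u]| <= a)%N].

(** A [k]-set that is not transversal contains two vertices of one class. There are at most
    [#|W| * a] such ordered pairs in [W], each inside at most ['C(#|W| - 2, k - 2)] sets. *)
Lemma card_inj_draws n (U : finType) (f : {ffun 'I_n -> U}) (a k : nat) (W : {set 'I_n}) :
  small_classes f a ->
  ('C(#|W|, k) <= #|[set S : {set 'I_n} | [&& S \subset W, #|S| == k & inj_on f S]]|
    + #|W| * a * 'C(#|W| - 2, k - 2))%N.
Proof.
move=> /forallP fa; rewrite -cards_draws; set A := [set S | _]; set B := [set S | _].
have AB : A \subset B :|: (A :\: B).
  by apply/subsetP => S SA; rewrite in_setU in_setD SA andbT orbN.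
apply: leq_trans (subset_leq_card AB) _.
apply: leq_trans (_ : #|B| + #|A :\: B| <= _)%N; first by rewrite cardsU leq_subr.
rewrite leq_add2l.
pose bad := [set x : 'I_n * 'I_n | [&& x.1 \in W, x.2 \in W, f x.1 == f x.2 & x.1 != x.2]].
have cbad : (#|bad| <= #|W| * a)%N.
  rewrite -sum1_card.
  have -> : (\sum_(x in bad) 1 = \sum_(u in W) \sum_(v | (u, v) \in bad) 1)%N.
    rewrite pair_big_dep /=; apply: eq_bigl => -[u v] /=.
    by rewrite !inE /=; case: (u \in W).
  rewrite -sum_nat_const; apply: leq_sum => u _; rewrite sum1_card.
  apply: leq_trans (fa u); apply: subset_leq_card; apply/subsetP => v uv.
  have : (u, v) \in bad by exact: uv.
  by rewrite !inE /= => /and4P[_ _ /eqP -> _].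
apply: leq_trans (_ : #|bad| * 'C(#|W| - 2, k - 2) <= _)%N; last by rewrite leq_mul2r cbad orbT.
have sAB : A :\: B \subset \bigcup_(x in bad)
   [set S : {set 'I_n} | [&& [set x.1; x.2] \subset S, S \subset W & #|S| == k]].
  apply/subsetP => S; rewrite !inE => /andP[nB /andP[SW Sk]].
  move: nB; rewrite SW Sk /= => /forall_inPn[u uS /forall_inPn[v vS]].
  rewrite negb_imply => /andP[fuv uv].
  apply/bigcupP; exists (u, v); rewrite !inE /=; last by rewrite SW Sk subUset !sub1set uS vS.
  by rewrite fuv uv !(subsetP SW).
apply: leq_trans (subset_leq_card sAB) _.
rewrite -sum_nat_const.
apply: leq_trans (_ : \sum_(x in bad) #|[set S : {set 'I_n} |
    [&& [set x.1; x.2] \subset S, S \subset W & #|S| == k]]| <= _)%N.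
  elim/big_ind2: _ => [|x1 x2 y1 y2 h1 h2|//]; first by rewrite cards0.
  by apply: leq_trans (leq_add h1 h2); rewrite cardsU leq_subr.
apply: leq_sum => x; rewrite inE => /and4P[x1 x2 _ x12].
have c2 : #|[set x.1; x.2]| = 2%N by rewrite cards2 x12.
by rewrite -c2; apply: card_between; rewrite subUset !sub1set x1 x2.
Qed.

(** Janson's inequality with [r] equal to half the probability that one set is independent; the
    hypothesis on [th] says that correlations eat at most the other half. The sum starts at [2]
    because sets sharing fewer than two vertices have disjoint pair sets. *)
Lemma janson_draws (R : realFieldType) n (p th : R) (W : {set 'I_n}) (k : nat)
    (F : {set {set 'I_n}}) :
  0 <= p <= 1 -> 0 <= th <= 1 ->
  (forall S : {set 'I_n}, S \in F -> (S \subset W) && (#|S| == k)) ->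
  th * (\sum_(2 <= l < k.+1) ('C(k, l) * 'C(#|W| - l, k - l))%N%:R *
          (1 - p) ^+ ('C(k, 2) + 'C(k, 2) - 'C(l, 2))) <= (1 - p) ^+ 'C(k, 2) / 2 ->
  Ex p (slots n) (fun E => [forall S in F, ~~ indep E S]%:R) <=
  (1 - th * ((1 - p) ^+ 'C(k, 2) / 2)) ^+ #|F|.
Proof.
move=> p01 th01 hF hth.
have q0 m : 0 <= (1 - p) ^+ m by rewrite exprn_ge0 //; have := p01; lra.
have th0 : 0 <= th by case/andP: th01.
pose Fs := map (@pairs n) (enum F).
have -> : #|F| = size Fs by rewrite size_map cardE.
apply: le_trans (_ : Ex p (slots n)
   (fun E => \prod_(Q <- Fs) (1 - th * (Q :&: E == set0)%:R)) <= _).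
  apply: Ex_le => // E.
  have P0 : 0 <= \prod_(Q <- Fs) (1 - th * (Q :&: E == set0)%:R).
    apply: prodr_ge0 => Q _; have := th01; case: (_ == _) => /=; lra.
  case: forall_inP => //= h; rewrite big_map big1_seq // => S /=.
  by rewrite mem_enum => /h /negPf; rewrite /indep => ->; rewrite mulr0 subr0.
apply: janson_prod => // [|Q]; first by apply: mulr_ge0 => //; lra.
case/mapP => S; rewrite mem_enum => SF ->.
have /andP[SW /eqP Sk] := hF _ SF.
rewrite count_slots ?pairs_subT // card_pairs Sk.
rewrite big_map big_enum_cond /=.
set X := \sum_(_ in F | _) _.
suff hX : X <= \sum_(2 <= l < k.+1) ('C(k, l) * 'C(#|W| - l, k - l))%N%:R *
          (1 - p) ^+ ('C(k, 2) + 'C(k, 2) - 'C(l, 2)).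
  by have := ler_wpM2l th0 hX; lra.
pose w l : R := (1 - p) ^+ ('C(k, 2) + 'C(k, 2) - 'C(l, 2)).
have -> : X = \sum_(S' in F | (1 < #|S :&: S'|)%N) w #|S :&: S'|.
  apply: eq_big => [S'|S' /andP[S'F _]].
    case: (S' \in F) => //=; rewrite pairsI -card_gt0 card_pairs.
    by rewrite bin_gt0.
  rewrite count_slots; last by rewrite subUset !pairs_subT.
  rewrite cardsU pairsI !card_pairs Sk.
  by have /andP[_ /eqP ->] := hF _ S'F.
apply: le_trans (_ : \sum_(S' : {set 'I_n} |
    [&& S' \subset W, #|S'| == k & (1 < #|S :&: S'|)%N]) w #|S :&: S'| <= _).
  rewrite [leLHS]big_mkcond [leRHS]big_mkcond /=; apply: ler_sum => S' _.
  case: ifP => [/andP[S'F ->]|_]; first by rewrite andbT hF.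
  by case: ifP => // _; apply: q0.
have key (S' : {set 'I_n}) : [&& S' \subset W, #|S'| == k & (1 < #|S :&: S'|)%N] ->
   w #|S :&: S'| = \sum_(2 <= l < k.+1) (#|S :&: S'| == l)%:R * w l.
  case/and3P => _ /eqP S'k c2; rewrite (bigD1_seq #|S :&: S'|) /= ?iota_uniq //.
    rewrite eqxx mul1r big1 ?addr0 // => l; rewrite eq_sym => /negPf ->.
    by rewrite mul0r.
  by rewrite mem_index_iota c2 ltnS -Sk subset_leq_card // subsetIl.
rewrite (eq_bigr _ key) exchange_big /=; apply: ler_sum => l _.
rewrite -mulr_suml; apply: ler_wpM2r; first exact: q0.
rewrite -natr_sum ler_nat.
apply: leq_trans (_ : #|[set S' : {set 'I_n} |
    [&& S' \subset W, #|S'| == k & #|S :&: S'| == l]]| <= _)%N; last first.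
  by rewrite -Sk; apply: card_inter_draws.
rewrite -sum1_card big_mkcond [leqRHS]big_mkcond /=; apply: leq_sum => S' _.
rewrite !inE; case: (S' \subset W) => //=; case: (#|S'| == k) => //=.
by case: ifP => // _; case: (_ == _).
Qed.

(** * Three graph properties and their failure probabilities *)

Definition has_transversal_indep n (k a m : nat) (E : {set 'I_n * 'I_n}) : bool :=
  [forall f : {ffun 'I_n -> 'I_n}, small_classes f a ==>
    [forall W : {set 'I_n}, (#|W| == m) ==>
      [exists S : {set 'I_n}, [&& S \subset W, #|S| == k, inj_on f S & indep E S]]]].

Definition no_large_indep n (a : nat) (E : {set 'I_n * 'I_n}) : bool :=
  [forall S : {set 'I_n}, (#|S| == a.+1) ==> ~~ indep E S].

(** Equivalently, every induced subgraph on fewer than [m] vertices is [D]-degenerate. *)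
Definition locally_sparse n (m D : nat) (E : {set 'I_n * 'I_n}) : bool :=
  [forall S : {set 'I_n}, (0 < #|S| < m)%N ==>
    [exists v in S, (#|[set u in S | adj E v u]| <= D)%N]].

Lemma prob_not_has_transversal_indep (R : realFieldType) n (p th : R) k a m :
  0 <= p <= 1 -> 0 <= th <= 1 ->
  th * (\sum_(2 <= l < k.+1) ('C(k, l) * 'C(m - l, k - l))%N%:R *
          (1 - p) ^+ ('C(k, 2) + 'C(k, 2) - 'C(l, 2))) <= (1 - p) ^+ 'C(k, 2) / 2 ->
  Ex p (slots n) (fun E => (~~ has_transversal_indep k a m E)%:R) <=
  (n ^ n * 2 ^ n)%N%:R *
  (1 - th * ((1 - p) ^+ 'C(k, 2) / 2)) ^+ ('C(m, k) - m * a * 'C(m - 2, k - 2))%N.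
Proof.
move=> p01 th01 hth; set z := 1 - _; set f0 := (_ - _)%N.
have z01 : 0 <= z <= 1.
  have q1 : 0 <= (1 - p) ^+ 'C(k, 2) <= 1.
    by rewrite exprn_ge0 ?exprn_ile1 //; have := p01; lra.
  have /andP[th0 th1] := th01.
  by apply/andP; rewrite /z; split; nra.
pose I := ({ffun 'I_n -> 'I_n} * {set 'I_n})%type.
pose FF (i : I) := [set S : {set 'I_n} | [&& S \subset i.2, #|S| == k & inj_on i.1 S]].
apply: le_trans (@Ex_union _ _ p (slots n) I (fun i => small_classes i.1 a && (#|i.2| == m))
  _ (fun i E => [forall S in FF i, ~~ indep E S]) p01 _) _.
  move=> E _; rewrite negb_forall => /existsP[f]; rewrite negb_imply => /andP[fa].
  rewrite negb_forall => /existsP[W]; rewrite negb_imply => /andP[Wm].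
  rewrite negb_exists => /forallP h; exists (f, W); rewrite /= ?fa ?Wm //.
  apply/forall_inP => S; rewrite inE => /and3P[h1 h2 h3].
  by have := h S; rewrite h1 h2 h3.
have -> : (n ^ n * 2 ^ n)%N = #|{: I}|.
  by rewrite card_prod card_ffun !card_ord -cardsT -powersetT card_powerset cardsT card_ord.
rewrite mulr_natl -sumr_const.
rewrite [leLHS]big_mkcond /=; apply: ler_sum => -[f W] _ /=.
case: ifP => [/andP[fa /eqP Wm]|_]; last by rewrite exprn_ge0 //; case/andP: z01.
apply: le_trans (janson_draws (k := k) (th := th) (W := W) p01 th01 _ _) _.
- by move=> S; rewrite inE => /and3P[-> -> _].
- by rewrite Wm.
apply: ler_wiXn2l; [by case/andP: z01|by case/andP: z01|].
rewrite /f0 leq_subLR addnC; have := @card_inj_draws _ _ f a k W fa.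
by rewrite Wm.
Qed.

Lemma prob_not_no_large_indep (R : realFieldType) n (p : R) a : 0 <= p <= 1 ->
  Ex p (slots n) (fun E => (~~ no_large_indep a E)%:R) <=
  'C(n, a.+1)%:R * (1 - p) ^+ 'C(a.+1, 2).
Proof.
move=> p01.
apply: le_trans (@Ex_union _ _ p (slots n) _ (fun S : {set 'I_n} => #|S| == a.+1)
  _ (fun S E => indep E S) p01 _) _.
  by move=> E _; rewrite negb_forall => /existsP[S];
     rewrite negb_imply negbK => /andP[h1 h2]; exists S.
rewrite (eq_bigr (fun _ => (1 - p) ^+ 'C(a.+1, 2))); last first.
  by move=> S /eqP Sa; rewrite Ex_avoid1 count_slots ?pairs_subT // card_pairs Sa.
rewrite sumr_const mulr_natl.
suff -> : #|[pred S : {set 'I_n} | #|S| == a.+1]| = 'C(n, a.+1) by [].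
by rewrite -[n in RHS]card_ord -card_draws; apply: eq_card => S; rewrite !inE.
Qed.

Lemma sum_deg n (E : {set 'I_n * 'I_n}) (S : {set 'I_n}) : edge_ok E ->
  (\sum_(v in S) #|[set u in S | adj E v u]| <= 2 * #|E :&: pairs S|)%N.
Proof.
move=> /forall_inP ok.
pose sw (x : 'I_n * 'I_n) := (x.2, x.1).
have swI : injective sw by apply: (can_inj (g := sw)); case.
apply: leq_trans (_ : #|(E :&: pairs S) :|: [set sw x | x in E :&: pairs S]| <= _)%N; last first.
  by rewrite mul2n -addnn -[X in (_ <= _ + X)%N](card_imset _ swI) cardsU leq_subr.
have -> : (\sum_(v in S) #|[set u in S | adj E v u]| =
   #|[set x : 'I_n * 'I_n | [&& x.1 \in S, x.2 \in S & adj E x.1 x.2]]|)%N.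
  rewrite -[RHS]sum1_card (eq_bigr (fun v => \sum_(u | (u \in S) && adj E v u) 1)%N).
    rewrite pair_big_dep /=; apply: eq_bigl => -[u v] /=; by rewrite !inE.
  by move=> v _; rewrite -sum1_card; apply: eq_bigl => u; rewrite inE.
apply: subset_leq_card; apply/subsetP => -[u v]; rewrite !inE /= => /and3P[uS vS].
case/orP => e; have /= l := ok _ e; first by rewrite uS vS l e.
apply/orP; right; apply/imsetP; exists (v, u) => //.
by rewrite !inE /= uS vS l e.
Qed.

(* Markov's inequality applied to [4 ^ e(S)], where [e(S)] is the number of edges
   inside [S]; if [S] has minimum degree above [D] then [2 e(S) >= D #|S|]. *)
Lemma prob_not_locally_sparse (R : realFieldType) n (p : R) m D : 0 <= p <= 1 ->
  Ex p (slots n) (fun E => (~~ locally_sparse m D E)%:R) <=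
  (1 + (1 + 3 * p) ^+ m / 2 ^+ D) ^+ n - 1.
Proof.
move=> p01; set y := _ / _.
have p3 : 1 <= 1 + 3 * p by have := p01; lra.
have y0 : 0 <= y by rewrite divr_ge0 ?exprn_ge0 //; lra.
pose bad (S : {set 'I_n}) (E : {set 'I_n * 'I_n}) :=
  edge_ok E && [forall v in S, (D < #|[set u in S | adj E v u]|)%N].
apply: le_trans (@Ex_union _ _ p (slots n) _ (fun S : {set 'I_n} => (0 < #|S| < m)%N)
  _ bad p01 _) _.
  move=> E Es; rewrite negb_forall => /existsP[S]; rewrite negb_imply => /andP[h1].
  rewrite negb_exists => /forallP h2; exists S => //; rewrite /bad edge_ok_slots //=.
  by apply/forall_inP => v vS; have := h2 v; rewrite vS /= -ltnNge.
(* The binomial theorem, grouped by subsets: the [- 1] removes the empty set. *)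
have -> : (1 + y) ^+ n - 1 = \sum_(S : {set 'I_n} | S != set0) y ^+ #|S|.
  apply/eqP; rewrite subr_eq [1 + y]addrC; apply/eqP.
  have -> : \sum_(S : {set 'I_n} | S != set0) y ^+ #|S| + 1 = \sum_(S : {set 'I_n}) y ^+ #|S|.
    by rewrite [RHS](bigD1 set0) //= cards0 expr0 addrC.
  rewrite addrC exprDn.
  rewrite (partition_big (fun S : {set 'I_n} => inord #|S| : 'I_n.+1) xpredT) //=.
  apply: eq_bigr => i _.
  rewrite (eq_bigl (fun S : {set 'I_n} => #|S| == i)); last first.
    move=> S; rewrite -val_eqE /= inordK // ltnS.
    by rewrite -[n in (_ <= n)%N]card_ord; apply: max_card.
  rewrite (eq_bigr (fun _ => y ^+ i)); last by move=> S /eqP ->.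
  rewrite sumr_const expr1n mul1r; congr (_ *+ _).
  have := card_draws 'I_n i; rewrite card_ord => <-.
  by apply: eq_card => S; rewrite !inE.
rewrite [leLHS]big_mkcond [leRHS]big_mkcond /=; apply: ler_sum => S _.
rewrite -card_gt0; case: (ltnP 0 #|S|) => //= S0.
case: ifP => Sm; last by rewrite exprn_ge0.
have two0 l : 0 < 2 ^+ l :> R by rewrite exprn_gt0.
apply: le_trans (_ : Ex p (slots n) (fun E => (2 ^+ (D * #|S|))^-1 * 4 ^+ #|E :&: pairs S|) <= _).
  apply: Ex_le => // E; rewrite mulrC ler_pdivlMr //.
  rewrite /bad; case: (boolP (edge_ok E)) => [ok|_] /=; last by rewrite mul0r exprn_ge0.
  case: forall_inP => [h|_]; rewrite ?mul1r ?mul0r ?exprn_ge0 //.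
  have -> : 4 = 2 ^+ 2 :> R by rewrite expr2; lra.
  rewrite -exprM ler_eXn2l ?ltr1n //.
  apply: leq_trans (sum_deg S ok); rewrite mulnC -sum_nat_const.
  by apply: leq_sum => v /h /ltnW.
rewrite Ex_scale Ex_expr_card ?enum_uniq // count_slots ?pairs_subT // card_pairs.
rewrite mulrC /y expr_div_n -!exprM ler_wpM2r ?invr_ge0 ?(ltW (two0 _)) //.
have -> : 1 + p * (4 - 1) = 1 + 3 * p by lra.
(* The exponent ['C(#|S|, 2)] is at most [m * #|S|], so the bound becomes a [#|S|]-th power and the
   sum over [S] is binomial. *)
rewrite ler_weXn2l // bin2 -divn2; apply: leq_trans (leq_div _ _) _.
by rewrite mulnC leq_mul2r (leq_trans (leq_pred _) (ltnW Sm)) orbT.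
Qed.

Local Close Scope ring_scope.
Local Open Scope nat_scope.

(** * Colorings built from independent sets *)

(** Remove a vertex with at most [d] neighbors, color the rest, and give it one of the [d + 1]
    colors that its neighbors leave free. *)
Lemma degenerate_coloring (T : finType) (e : rel T) (d m : nat) :
  symmetric e -> irreflexive e ->
  (forall S : {set T}, 0 < #|S| < m -> exists2 v, v \in S & #|[set u in S | e v u]| <= d) ->
  forall S : {set T}, #|S| < m ->
  exists2 g : T -> nat, {in S &, forall u v, e u v -> g u != g v} &
    {in S, forall u, g u <= d}.
Proof.
move=> sym irr deg S; move: {2}#|S| (erefl #|S|) => s.
elim: s S => [|s IH] S cS Sm.
  exists (fun _ => 0) => [u v|u]; rewrite (cards0_eq cS) ?inE //.
have [|v vS dv] := deg S; first by rewrite cS in Sm *.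
have cS' : #|S :\ v| = s by have := cardsD1 v S; rewrite vS cS => -[].
have [|g gE gd] := IH _ cS'; first by rewrite cS'; rewrite cS in Sm; apply: ltnW.
pose N := [set u in S | e v u].
pose cs := [seq g u | u <- enum N].
have [c cd cN] : exists2 c, c <= d & c \notin cs.
  have [/allP h|] := boolP (all (mem cs) (iota 0 d.+1)).
    have := uniq_leq_size (iota_uniq 0 d.+1) h.
    by rewrite size_iota size_map -cardE ltnNge dv.
  by case/allPn => c; rewrite mem_iota /= add0n ltnS => cd cN; exists c.
exists (fun u => if u == v then c else g u) => [x y xS yS exy|x xS].
  have cg z : z \in S -> e v z -> c != g z.
    move=> zS evz; apply: contraNneq cN => ->; apply/mapP; exists z => //.
    by rewrite mem_enum inE zS.
  case: (x =P v) => [xv|/eqP xv]; case: (y =P v) => [yv|/eqP yv].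
  - by move: exy; rewrite xv yv irr.
  - by apply: cg => //; rewrite -xv.
  - by rewrite eq_sym; apply: cg => //; rewrite sym -yv.
  - by apply: gE => //; rewrite !inE ?xv ?yv.
by case: (x =P v) => // /eqP xv; apply: gd; rewrite !inE xv.
Qed.

Lemma greedy_coloring (T : finType) (e : rel T) (d m k : nat) : 0 < k ->
  symmetric e -> irreflexive e ->
  (forall S : {set T}, 0 < #|S| < m -> exists2 v, v \in S & #|[set u in S | e v u]| <= d) ->
  (forall W : {set T}, #|W| = m ->
     exists S : {set T}, [/\ S \subset W, #|S| = k & {in S &, forall u v, ~~ e u v}]) ->
  exists2 g : T -> nat, forall u v, e u v -> g u != g v &
    forall u, g u < #|T| %/ k + d.+1.
Proof.
move=> k0 sym irr deg big.
suff H s (W : {set T}) : #|W| = s -> exists2 g : T -> nat,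
    {in W &, forall u v, e u v -> g u != g v} & {in W, forall u, g u < s %/ k + d.+1}.
  have [|g g1 g2] := H #|T| [set: T]; first by rewrite cardsT.
  by exists g => [u v|u]; [apply: g1|apply: g2]; rewrite inE.
elim/ltn_ind: s W => s IH W Ws.
have [Wm|mW] := ltnP #|W| m.
  have [g g1 g2] := degenerate_coloring sym irr deg Wm.
  by exists g => // u uW; rewrite ltn_addl // ltnS g2.
have [W' /andP[W'W /eqP W'm]] : exists W' : {set T}, (W' \subset W) && (#|W'| == m).
  have : 0 < #|[set W' : {set T} | W' \subset W & #|W'| == m]|.
    by rewrite cards_draws bin_gt0.
  by case/card_gt0P => W'; rewrite inE; exists W'.
have [S [SW' Sk Sind]] := big W' W'm.
have SW := subset_trans SW' W'W.
have ks : k <= s by rewrite -Ws -Sk subset_leq_card.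
have cWS : #|W :\: S| = s - k by rewrite cardsD (setIidPr SW) Ws Sk.
have [|g g1 g2] := IH (s - k) _ _ cWS; first by lia.
have dk : s %/ k = ((s - k) %/ k).+1 by rewrite -{1}(subnK ks) divnDr // divnn k0 addn1.
(* The extracted set receives the first color above the range allowed for [W :\: S]. *)
exists (fun u => if u \in S then (s - k) %/ k + d.+1 else g u) => [u v uW vW euv|u uW].
  case: ifP => uS; case: ifP => vS.
  - by move: (Sind u v uS vS); rewrite euv.
  - by rewrite neq_ltn (g2 v) ?orbT // inE vS.
  - by rewrite neq_ltn (g2 u) // inE uS.
  - by apply: g1; rewrite ?inE ?uS ?vS.
rewrite dk addSn ltnS; case: ifP => // uS.
by apply: ltnW; apply: g2; rewrite inE uS.
Qed.

Lemma adj_sym n (E : {set 'I_n * 'I_n}) : symmetric (adj E).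
Proof. by move=> u v; rewrite /adj orbC. Qed.

Lemma adj_irr n (E : {set 'I_n * 'I_n}) : edge_ok E -> irreflexive (adj E).
Proof.
move=> /forall_inP ok u; rewrite /adj orbb; apply/negP => /ok /=.
by rewrite ltnn.
Qed.

(** Greedy coloring is applied to the graph enlarged by all edges inside the classes of [f]: proper
    colorings of it separate vertices of one class, its independent sets are the transversal ones,
    and degrees grow by at most [a]. *)
Lemma proper_transversal_coloring n (E : {set 'I_n * 'I_n}) (k a m D : nat)
    (f : {ffun 'I_n -> 'I_n}) :
  edge_ok E -> 0 < k -> has_transversal_indep k a m E ->
  locally_sparse m D E -> small_classes f a ->
  exists g : 'I_n -> nat, [/\ forall u v, adj E u v -> g u != g v,
     forall u v, u != v -> f u == f v -> g u != g v &
     forall u, g u < n %/ k + (D + a).+1].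
Proof.
move=> ok k0 /forallP h1 /forallP h3 fa.
pose e u v := adj E u v || (u != v) && (f u == f v).
have sym : symmetric e by move=> u v; rewrite /e adj_sym eq_sym [f u == _]eq_sym.
have irr : irreflexive e by move=> u; rewrite /e adj_irr // eqxx.
have [S Sm|W Wm|g g1 g2] := greedy_coloring (d := D + a) (m := m) k0 sym irr.
- have := h3 S; rewrite Sm /= => /exists_inP[v vS dv]; exists v => //.
  apply: leq_trans (_ : #|[set u in S | adj E v u] :|: [set u | f u == f v]| <= _).
    apply: subset_leq_card; apply/subsetP => u; rewrite !inE /e => /andP[-> /=].
    by case/orP => [->//|/andP[_ h]]; rewrite [f u == _]eq_sym h orbT.
  rewrite cardsU; apply: leq_trans (leq_subr _ _) _.
  by apply: leq_add => //; apply: (forallP fa).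
- have := h1 f; rewrite fa /= => /forallP/(_ W); rewrite Wm eqxx /=.
  case/existsP => S /and4P[SW /eqP Sk /forall_inP inj ind]; exists S; split=> // u v uS vS.
  rewrite /e negb_or; have /(indepP _ ok) -> // := ind.
  have /forall_inP/(_ v vS)/implyP h := inj u uS.
  by rewrite negb_and negbK /=; case: eqP => //= /eqP uv; apply: contra uv.
exists g; split=> [u v uv|u v uv fuv|u].
- by apply: g1; rewrite /e uv.
- by apply: g1; rewrite /e uv fuv orbT.
- by have := g2 u; rewrite card_ord.
Qed.

Lemma indep_card n (E : {set 'I_n * 'I_n}) (a : nat) (S : {set 'I_n}) :
  no_large_indep a E -> indep E S -> #|S| <= a.
Proof.
move=> /forallP h2 ind; rewrite leqNgt; apply/negP => aS.
have : 0 < #|[set S' : {set 'I_n} | S' \subset S & #|S'| == a.+1]|.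
  by rewrite cards_draws bin_gt0.
case/card_gt0P => S'; rewrite inE => /andP[SS S'a].
have /negP := implyP (h2 S') S'a; apply.
rewrite /indep -subset0 -(eqP ind) setSI //.
apply/subsetP => x; rewrite !inE => /and3P[x1 x2 ->].
by rewrite !(subsetP SS).
Qed.

(** [find] returns the out-of-range index [N.+1] when nothing is found; a witness [K <= N] excludes
    this, so the index is a genuine least value. *)
Lemma find_iota_le (P : pred nat) N K : K <= N -> P K ->
  P (find P (iota 0 N.+1)) /\ find P (iota 0 N.+1) <= K.
Proof.
move=> KN PK.
have h : has P (iota 0 N.+1) by apply/hasP; exists K => //; rewrite mem_iota.
have := h; rewrite has_find size_iota => lt.
split; first by have := nth_find 0 h; rewrite nth_iota.
rewrite leqNgt; apply/negP => hK.
by have := before_find 0 hK; rewrite nth_iota // ?add0n ?PK // ltnS.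
Qed.

Lemma colorable_lower n (E : {set 'I_n * 'I_n}) (a K : nat) :
  edge_ok E -> no_large_indep a E -> colorable E K -> n <= K * a.
Proof.
move=> ok h2 /existsP[f /forallP hf].
have -> : n = \sum_(c : 'I_K) #|[set v | f v == c]|.
  rewrite -[LHS]card_ord -sum1_card (partition_big f xpredT) //=.
  by apply: eq_bigr => c _; rewrite -sum1_card; apply: eq_bigl => v; rewrite inE.
rewrite -[K in K * a]card_ord -sum_nat_const; apply: leq_sum => c _.
apply: (indep_card h2); apply/indepP => // u v; rewrite !inE => /eqP fu /eqP fv.
apply/negP => uv; have /forallP/(_ v) := hf u.
by rewrite uv fu fv eqxx.
Qed.

Lemma tone_colorable_lower n (E : {set 'I_n * 'I_n}) (t a K : nat) :
  edge_ok E -> no_large_indep a E -> tone_colorable E t K -> t * n <= K * a.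
Proof.
move=> ok h2 /existsP[f /andP[/forallP ft /forallP hf]].
have -> : t * n = \sum_(c : 'I_K) #|[set v | c \in f v]|.
  rewrite mulnC -[n in LHS]card_ord -sum_nat_const.
  transitivity (\sum_(v : 'I_n) \sum_(c : 'I_K) (c \in f v : nat)).
    apply: eq_bigr => v _; rewrite -(eqP (ft v)) -sum1_card big_mkcond /=.
    by apply: eq_bigr => c _; case: (_ \in _).
  rewrite exchange_big; apply: eq_bigr => c _.
  rewrite -sum1_card [RHS]big_mkcond /=; apply: eq_bigr => v _; rewrite inE.
  by case: (_ \in _).
rewrite -[K in K * a]card_ord -sum_nat_const; apply: leq_sum => c _.
apply: (indep_card h2); apply/indepP => // u v; rewrite !inE => fu fv.
apply/negP => uv; have /forallP/(_ v) := hf u.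
have -> : u != v by apply: contraTneq uv => ->; rewrite adj_irr.
rewrite implyTb; apply/negP; rewrite negbK.
(* A shared color makes the intersection size at least [1]; adjacency gives distance at most [1],
   and balls grow with the radius. *)
have : 0 < #|f u :&: f v| by apply/card_gt0P; exists c; rewrite inE fu.
case: #|_ :&: _| => // l _; rewrite /dist_le.
elim: l => [|l IH]; last by rewrite /= in IH *; rewrite inE IH.
by rewrite /= !inE; apply/orP; right; apply/exists_inP; exists u; rewrite ?inE.
Qed.

Lemma chi_tau_bounds n (E : {set 'I_n * 'I_n}) (k a m D : nat) :
  edge_ok E -> 0 < k -> 0 < a -> has_transversal_indep k a m E ->
  no_large_indep a E -> locally_sparse m D E ->
  let K := n %/ k + (D + a).+1 in K <= n ->
  [/\ chi E <= K, tau 2 E <= 2 * K, n <= chi E * a & 2 * n <= tau 2 E * a].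
Proof.
move=> ok k0 a0 h1 h2 h3 K Kn.
have id_small : small_classes [ffun x : 'I_n => x] a.
  apply/forallP => u; apply: leq_trans a0; rewrite -(cards1 u).
  by apply: subset_leq_card; apply/subsetP => v; rewrite !inE !ffunE.
have [g [g1 _ g3]] := proper_transversal_coloring ok k0 h1 h3 id_small.
(* [K <= n] lets the first coloring take values in ['I_n], as required of a partition in
   [has_transversal_indep]. *)
pose f : {ffun 'I_n -> 'I_n} := [ffun u => Ordinal (leq_trans (g3 u) Kn)].
have f_small : small_classes f a.
  apply/forallP => u; apply: (indep_card h2); apply/indepP => // x y.
  rewrite !inE => /eqP fx /eqP fy; apply/negP => /g1 /negP; apply.
  have : f x = f y by rewrite fx fy.
  by rewrite !ffunE => -[->].
have [g' [g'1 g'2 g'3]] := proper_transversal_coloring ok k0 h1 h3 f_small.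
have cK : colorable E K.
  apply/existsP; exists [ffun u => Ordinal (g3 u)].
  apply/forallP => u; apply/forallP => v; apply/implyP => /g1.
  by rewrite !ffunE -val_eqE.
have tK : tone_colorable E 2 (K + K).
  pose h : {ffun 'I_n -> {set 'I_(K + K)}} :=
    [ffun u => [set lshift K (Ordinal (g3 u)); rshift K (Ordinal (g'3 u))]].
  have hE u v : h u :&: h v =
     (if g u == g v then [set lshift K (Ordinal (g3 u))] else set0) :|:
     (if g' u == g' v then [set rshift K (Ordinal (g'3 u))] else set0).
    apply/setP => c; rewrite !ffunE !inE.
    case: (splitP c) => c' cE.
      have -> : c = lshift K c' by apply: val_inj.
      rewrite !(inj_eq (@lshift_inj _ _)) !eq_lrshift !orbF -!val_eqE /=.
      have -> : (lshift K c' \in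
          (if g' u == g' v then [set rshift K (Ordinal (g'3 u))] else set0)) = false.
        by case: ifP => _; rewrite inE ?eq_lrshift.
      rewrite orbF; case: (g u =P g v) => [guv|guv]; rewrite !inE.
        by rewrite (inj_eq (@lshift_inj _ _)) -val_eqE /= -guv andbb.
      by apply/negP => /andP[/eqP h1' /eqP h2']; apply: guv; rewrite -h1' -h2'.
    have -> : c = rshift K c' by apply: val_inj.
    rewrite !(inj_eq (@rshift_inj _ _)) !eq_rlshift /= -!val_eqE /=.
    have -> : (rshift K c' \in
        (if g u == g v then [set lshift K (Ordinal (g3 u))] else set0)) = false.
      by case: ifP => _; rewrite inE ?eq_rlshift.
    case: (g' u =P g' v) => [guv|guv]; rewrite !inE.
      by rewrite (inj_eq (@rshift_inj _ _)) -val_eqE /= -guv andbb.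
    by apply/negP => /andP[/eqP h1' /eqP h2']; apply: guv; rewrite -h1' -h2'.
  apply/existsP; exists h; apply/andP; split; apply/forallP => u.
    by rewrite ffunE cards2 eq_lrshift.
  apply/forallP => v; apply/implyP => uv; rewrite hE.
  (* Adjacent vertices get disjoint labels. Otherwise the distance exceeds [1], so labels sharing at
     most one color are allowed. *)
  have [auv|nauv] := boolP (adj E u v).
    by rewrite (negPf (g1 _ _ auv)) (negPf (g'1 _ _ auv)) setU0 cards0 /dist_le inE eq_sym.
  have n1 : ~~ dist_le E u v 1.
    rewrite /dist_le /= !inE eq_sym (negPf uv) /=; apply/exists_inP => -[x].
    by rewrite inE => /eqP ->; rewrite (negPf nauv).
  have n0 : ~~ dist_le E u v 0 by rewrite /dist_le inE eq_sym.
  (* Equal first colors mean equal classes of [f], which the second coloring separates. *)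
  have [guv|_] := boolP (g u == g v).
    have fuv : f u == f v by rewrite !ffunE -val_eqE.
    by rewrite (negPf (g'2 _ _ uv fuv)) setU0 cards1.
  by case: ifP => _; rewrite set0U ?cards1 ?cards0.
have [c1 c2] := find_iota_le Kn cK.
have K2 : K + K <= 2 * n by rewrite addnn -mul2n leq_mul2l Kn orbT.
have [t1 t2] := find_iota_le K2 tK.
split=> //; first by rewrite mul2n -addnn.
  exact: colorable_lower c1.
exact: tone_colorable_lower t1.
Qed.

Local Close Scope nat_scope.
Local Open Scope ring_scope.
Local Arguments exp _%_R.
Local Arguments ln _%_R.

(** * Probability bounds *)

Lemma gnp_prob_Ex n (p : R) (A : {set 'I_n * 'I_n} -> bool) :
  gnp_prob p A = Ex p (slots n) (fun E => (A E)%:R).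
Proof.
rewrite Ex_sum_weight ?enum_uniq //.
rewrite /gnp_prob [RHS](bigID A) /= [X in _ = _ + X]big1 ?addr0; last first.
  by move=> E /andP[_ /negPf ->]; rewrite mulr0.
apply: eq_big => [E|E /andP[_ AE]].
  rewrite edge_ok_sub; congr (_ && _); apply: eq_subset_r => x.
  by rewrite mem_enum.
by rewrite AE mulr1 /gnp_weight !RpowE size_slots.
Qed.

Lemma gnp_prob_bounds n (p : R) (A : {set 'I_n * 'I_n} -> bool)
    (B1 B2 B3 : {set 'I_n * 'I_n} -> bool) (b1 b2 b3 : R) :
  0 <= p <= 1 ->
  (forall E, edge_ok E -> B1 E -> B2 E -> B3 E -> A E) ->
  Ex p (slots n) (fun E => (~~ B1 E)%:R) <= b1 ->
  Ex p (slots n) (fun E => (~~ B2 E)%:R) <= b2 ->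
  Ex p (slots n) (fun E => (~~ B3 E)%:R) <= b3 ->
  1 - (b1 + b2 + b3) <= gnp_prob p A <= 1.
Proof.
move=> p01 BA h1 h2 h3; rewrite gnp_prob_Ex; apply/andP; split; last first.
  rewrite -[leRHS](Ex_const p (slots n)); apply: Ex_le => // E.
  by case: (A E); rewrite ?ler01.
have : Ex p (slots n) (fun=> 1) <= Ex p (slots n) (fun E : {set 'I_n * 'I_n} => (A E)%:R
   + ((~~ B1 E)%:R + ((~~ B2 E)%:R + (~~ B3 E)%:R))).
  apply: Ex_le_in => // E /edge_ok_slots ok; have := BA E ok.
  case: (B1 E); case: (B2 E); case: (B3 E) => //=; case: (A E) => //= h;
    by rewrite ?mulr1n ?mulr0n; lra.
rewrite Ex_const !Ex_add; lra.
Qed.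

(** * Binomial estimates and the overlap sum *)

Lemma bin_trinomial (m k l : nat) : (l <= k <= m)%N ->
  ('C(k, l) * 'C(m, k) = 'C(m, l) * 'C(m - l, k - l))%N.
Proof.
case/andP => lk km; have lm := leq_trans lk km.
have f0 : (0 < l`! * (k - l)`! * (m - k)`!)%N by rewrite !muln_gt0 !fact_gt0.
apply/eqP; rewrite -(eqn_pmul2r f0); apply/eqP.
have h1 := bin_fact km; have h2 := bin_fact lk; have h3 := bin_fact lm.
have kl : (k - l <= m - l)%N by lia.
have h4 := bin_fact kl.
have e : (m - l - (k - l) = m - k)%N by lia.
rewrite e in h4.
transitivity ('C(m, k) * ('C(k, l) * (l`! * (k - l)`!) * (m - k)`!))%N; first by ring.
rewrite h2 h1 -h3 -h4; ring.
Qed.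

Lemma bin_ratio (m k l : nat) : (k <= m)%N ->
  ('C(k, l) * m ^ l <= 'C(m, l) * k ^ l)%N.
Proof.
move=> km; elim: l => [|l IH]; first by rewrite !bin0 !expn0.
rewrite -(leq_pmul2l (ltn0Sn l)) !expnS !mulnA !mul_bin_left.
have [kl|lk] := leqP k l; first by have -> : (k - l = 0)%N by lia.
have h : ((k - l) * m <= (m - l) * k)%N by nia.
have := leq_mul h IH; congr (_ <= _)%N; ring.
Qed.

Lemma bin_fact_le (k l : nat) : ('C(k, l) * l`! <= k ^ l)%N.
Proof.
elim: l => [|l IH]; first by rewrite bin0 expn0.
rewrite factS mulnA [('C(_, _) * _)%N]mulnC mul_bin_left -mulnA expnS.
by apply: leq_mul => //; apply: leq_subr.
Qed.

Lemma one_plus_le_exp (x : R) : 1 + x <= exp x.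
Proof. by apply/RleP; apply: exp_ineq1_le. Qed.

Lemma expr_exp_mul (x : R) (n : nat) : exp x ^+ n = exp (n%:R * x).
Proof. by rewrite expRX mulr_natl. Qed.

Lemma exp_gt0 (x : R) : 0 < exp x.
Proof. by apply/RltP; apply: exp_pos. Qed.

Lemma exp_monotone (x y : R) : x <= y -> exp x <= exp y.
Proof. by move=> /RleP xy; apply/RleP/exp_le_compat. Qed.

Lemma pow_fact_exp (l : nat) : (l%:R : R) ^+ l <= exp 1 ^+ l * l`!%:R.
Proof.
elim: l => [|l IH]; first by rewrite !expr0 fact0 mulr1.
rewrite factS natrM exprS [exp 1 ^+ _]exprS.
have [->|l0] := posnP l.
  by rewrite !expr0 fact0 !mulr1; have : 1 + 1 <= exp 1 := one_plus_le_exp _; lra.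
have lR : 0 < l%:R :> R by rewrite ltr0n.
suff h : (l.+1%:R : R) ^+ l <= exp 1 * l%:R ^+ l.
  have := ler_wpM2l (ltW (exp_gt0 1)) IH.
  move=> h2; have := ler_wpM2l (ler0n R l.+1) (le_trans h h2).
  by congr (_ <= _); ring.
have -> : (l.+1%:R : R) = l%:R * (1 + l%:R^-1).
  by rewrite mulrDr mulr1 mulfV ?gt_eqF // -addn1 natrD.
rewrite exprMn mulrC ler_wpM2r ?exprn_ge0 ?(ltW lR) //.
apply: le_trans (_ : exp (l%:R^-1) ^+ l <= _).
  by apply: lerXn2r; rewrite ?nnegrE ?(ltW (exp_gt0 _)) ?one_plus_le_exp //
    addr_ge0 ?invr_ge0 ?(ltW lR).
by rewrite expr_exp_mul mulfV ?gt_eqF.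
Qed.

Lemma bin_le_exp (k l : nat) : (0 < l)%N ->
  ('C(k, l)%:R : R) <= (exp 1 * k%:R / l%:R) ^+ l.
Proof.
move=> l0; have lR : 0 < l%:R :> R by rewrite ltr0n.
rewrite expr_div_n ler_pdivlMr ?exprn_gt0 // exprMn.
apply: le_trans (ler_wpM2l (ler0n _ _) (pow_fact_exp l)) _.
rewrite mulrCA ler_wpM2l ?exprn_ge0 ?(ltW (exp_gt0 _)) //.
by rewrite -natrM -natrX ler_nat bin_fact_le.
Qed.

(* Bounds the contribution to (second moment) / (first moment)^2 for the number of
   independent [k]-subsets of an [m]-set of the pairs meeting in [l] vertices. *)
Definition overlap (K : realFieldType) (p : K) (m k l : nat) : K :=
  'C(k, l)%:R ^+ 2 / 'C(m, l)%:R * (1 - p)^-1 ^+ 'C(l, 2).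

Lemma overlap_ge0 (p : R) (m k l : nat) : p < 1 -> 0 <= overlap p m k l.
Proof.
move=> p1; rewrite /overlap mulr_ge0 ?exprn_ge0 ?divr_ge0 ?exprn_ge0 //.
by rewrite invr_ge0; lra.
Qed.

(** One factor ['C(k, l)] is bounded by [(e k / l)^l]; the other, divided by ['C(m, l)], by
    [(k / m)^l]. *)
Lemma overlap_le (p : R) (m k l : nat) : p < 1 -> (0 < l <= k)%N -> (k <= m)%N ->
  overlap p m k l <=
  (exp 1 * k%:R / l%:R * (k%:R / m%:R)) ^+ l * (1 - p)^-1 ^+ 'C(l, 2).
Proof.
move=> p1 /andP[l0 lk] km; apply: ler_wpM2r.
  by rewrite exprn_ge0 // invr_ge0; lra.
have m0 : 0 < m%:R :> R by rewrite ltr0n; lia.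
rewrite exprMn; apply: le_trans (_ : 'C(k, l)%:R * ('C(k, l)%:R / 'C(m, l)%:R) <= _).
  by rewrite mulrA expr2.
apply: ler_pM; rewrite ?ler0n ?divr_ge0 //.
  exact: bin_le_exp.
have C0 : 0 < 'C(m, l)%:R :> R by rewrite ltr0n bin_gt0; lia.
rewrite expr_div_n ler_pdivrMr // mulrAC ler_pdivlMr ?exprn_gt0 //.
by rewrite -!natrX -!natrM ler_nat mulnC [leqRHS]mulnC mulnC bin_ratio.
Qed.

(** The rate [th = 1 / (2 Q S)] is the largest one that the correlation condition allows, and makes
    each factor [1 - 1 / (4 S)]. At least ['C(m, k) / 2] sets are transversal, and [S] is ['C(m, k)]
    times the overlap sum, whence the [8]. *)
Lemma prob_not_has_transversal_indep_exp n (p : R) (k a m : nat) : 0 <= p < 1 ->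
  (2 <= k <= m)%N -> (2 * a * k ^ 2 < m)%N ->
  Ex p (slots n) (fun E => (~~ has_transversal_indep k a m E)%:R) <=
  (n ^ n * 2 ^ n)%N%:R * exp (- (8 * \sum_(2 <= l < k.+1) overlap p m k l)^-1).
Proof.
move=> /andP[p0 p1] /andP[k2 km] akm.
have p01 : 0 <= p <= 1 by lra.
have q0 : 0 < 1 - p by lra.
set Q := (1 - p) ^+ 'C(k, 2); have Q0 : 0 < Q by rewrite exprn_gt0.
pose S := \sum_(2 <= l < k.+1) ('C(k, l) * 'C(m - l, k - l))%N%:R * (1 - p)^-1 ^+ 'C(l, 2).
have mk0 : 0 < 'C(m, k)%:R :> R by rewrite ltr0n bin_gt0.
have SE : S = 'C(m, k)%:R * \sum_(2 <= l < k.+1) overlap p m k l.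
  rewrite mulr_sumr; apply: eq_big_nat => l /andP[_]; rewrite ltnS => lk.
  rewrite /overlap mulrA; congr (_ * _).
  have C0 : 'C(m, l)%:R != 0 :> R by rewrite pnatr_eq0 -lt0n bin_gt0; lia.
  rewrite natrM; apply: (mulIf C0); rewrite -mulrA -natrM [('C(m - l, _) * _)%N]mulnC.
  rewrite -bin_trinomial ?lk //.
  by rewrite natrM; field.
have QSE : \sum_(2 <= l < k.+1) ('C(k, l) * 'C(m - l, k - l))%N%:R *
    (1 - p) ^+ ('C(k, 2) + 'C(k, 2) - 'C(l, 2)) = Q ^+ 2 * S.
  rewrite mulr_sumr; apply: eq_big_nat => l /andP[_]; rewrite ltnS => lk.
  rewrite mulrCA; congr (_ * _).
  rewrite /Q -exprM exprVn expfB_cond ?muln2 ?addnn //.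
  by rewrite gt_eqF //= add0n -addnn (leq_trans (leq_bin2l _ lk)) ?leq_addr.
(* The term [l = k], a set paired with itself, already contributes [1 / Q] to [S]; hence
   [th <= 1]. *)
have S1 : 1 <= Q * S.
  rewrite /S big_nat_recr //= binn subnn bin0 mul1r mulrDr -[Q in X in _ <= _ + X]/((1 - p) ^+ _).
  rewrite exprVn mulfV ?gt_eqF // lerDr mulr_ge0 ?(ltW Q0) //.
  by apply: sumr_ge0 => l _; rewrite mulr_ge0 ?exprn_ge0 ?invr_ge0 ?(ltW q0).
have S0 : 0 < S by rewrite -(pmulr_rgt0 _ Q0); lra.
pose th := (2 * (Q * S))^-1.
have th01 : 0 <= th <= 1.
  rewrite /th invr_ge0 invf_le1; lra.
apply: le_trans (prob_not_has_transversal_indep (m := m) (k := k) n a p01 th01 _) _.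
  rewrite QSE /th -/Q; have -> : (2 * (Q * S))^-1 * (Q ^+ 2 * S) = Q / 2; last by [].
  by field; rewrite !gt_eqF.
rewrite ler_wpM2l // -/Q.
have -> : th * (Q / 2) = (4 * S)^-1 by rewrite /th; field; rewrite !gt_eqF.
have x1 : 0 <= 1 - (4 * S)^-1.
  have : (4 * S)^-1 <= 1; last lra.
  have Q1 : Q <= 1 by rewrite exprn_ile1; lra.
  rewrite invf_le1; nra.
set f0 := (_ - _)%N.
apply: le_trans (_ : exp (- (4 * S)^-1) ^+ f0 <= _).
  by apply: lerXn2r; rewrite ?nnegrE ?(ltW (exp_gt0 _)) ?one_plus_le_exp.
rewrite expr_exp_mul.
have hf : ('C(m, k) <= 2 * f0)%N.
  have C2 : (0 < 'C(m, 2))%N by rewrite bin_gt0 (leq_trans k2 km).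
  suff h : (2 * (m * a * 'C(m - 2, k - 2)) <= 'C(m, k))%N.
    by move: h; rewrite /f0; move: ('C(m, k))%N (m * a * _)%N => c x; clear; lia.
  rewrite -(leq_pmul2l C2).
  (* The trinomial identity reduces the claim to [2 a k (k - 1) <= m - 1]. *)
  have e : ('C(m, 2) * (2 * (m * a * 'C(m - 2, k - 2))) = (2 * (m * a) * 'C(k, 2)) * 'C(m, k))%N.
    by rewrite -[RHS]mulnA bin_trinomial ?k2 //; ring.
  rewrite e leq_mul2r; apply/orP; right.
  rewrite !bin2 -leq_double (double_half_mul_pred m) -muln2 -mulnA muln2.
  rewrite double_half_mul_pred.
  have : (2 * a * (k * k.-1) <= m.-1)%N.
    have : (k * k.-1 <= k ^ 2)%N by rewrite expnS expn1 leq_mul2l leq_pred orbT.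
    move=> h; apply: leq_trans (leq_mul (leqnn _) h) _.
    by rewrite -ltnS prednK // (leq_ltn_trans _ akm).
  set k1 := (k * k.-1)%N => h.
  have -> : (2 * (m * a) * k1 = m * (2 * a * k1))%N by ring.
  by rewrite leq_mul2l h orbT.
have S8 : (8 * \sum_(2 <= l < k.+1) overlap p m k l)^-1 = 'C(m, k)%:R * (8 * S)^-1.
  by rewrite SE; field; move: S0; rewrite SE (pmulr_rgt0 _ mk0) => h; rewrite !gt_eqF.
rewrite S8; apply: exp_monotone; rewrite mulrN lerN2.
have -> : f0%:R * (4 * S)^-1 = (2 * f0)%N%:R * (8 * S)^-1.
  by rewrite natrM; field; rewrite gt_eqF.
by rewrite ler_wpM2r ?ler_nat // invr_ge0; lra.
Qed.

Lemma exp_lnK (x : R) : 0 < x -> exp (ln x) = x.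
Proof. by move=> /RltP; apply: exp_ln. Qed.

Lemma expr_bin2 (c : R) (l : nat) : (c ^+ 2) ^+ 'C(l, 2) = (c ^+ l.-1) ^+ l.
Proof. by rewrite -!exprM bin2 mul2n double_half_mul_pred mulnC. Qed.

Lemma overlap_le_exp (p : R) (m k l : nat) : 0 <= p < 1 -> (0 < l <= k)%N -> (k <= m)%N ->
  overlap p m k l <=
  (exp 1 * k%:R / l%:R * (k%:R / m%:R) * exp (- ln (1 - p) / 2 * l%:R)) ^+ l.
Proof.
move=> /andP[p0 p1] lk km; apply: le_trans (overlap_le p1 lk km) _.
have /andP[l0 _] := lk.
have q0 : 0 < 1 - p by lra.
rewrite [leRHS]exprMn ler_wpM2l //.
  by rewrite exprn_ge0 // !mulr_ge0 ?divr_ge0 ?mulr_ge0 ?ler0n ?(ltW (exp_gt0 _)) ?invr_ge0.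
(* [c] is [(1 - p)^(-1/2)]: then [(1 - p)^(-'C(l, 2))] is the [l]-th power of [c^(l-1)], which is
   relaxed to [c^l]. *)
pose c := exp (- ln (1 - p) / 2).
have c2 : (1 - p)^-1 = c ^+ 2.
  rewrite /c expr_exp_mul; have -> : 2%:R * (- ln (1 - p) / 2) = - ln (1 - p) by field.
  have -> : exp (- ln (1 - p)) = (exp (ln (1 - p)))^-1 by exact: exp_Ropp.
  by rewrite exp_lnK.
have c1 : 1 <= c.
  have : 1 <= c ^+ 2 by rewrite -c2 invf_ge1 //; lra.
  by rewrite -[1 in X in X -> _](expr1n _ 2) ler_pXn2r ?nnegrE ?ler01 ?(ltW (exp_gt0 _)).
rewrite c2 expr_bin2 mulrC -expr_exp_mul -/c.
apply: lerXn2r; rewrite ?nnegrE ?exprn_ge0 ?(le_trans ler01 c1) //.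
by rewrite ler_weXn2l ?leq_pred.
Qed.

Lemma overlap_sum_le (p : R) (m k l0 : nat) (X rho : R) :
  0 <= p < 1 -> (2 <= k <= m)%N -> 0 <= X <= 1 -> 0 <= rho <= 1 ->
  let z l := exp 1 * k%:R / l%:R * (k%:R / m%:R) * exp (- ln (1 - p) / 2 * l%:R) in
  (forall l, (2 <= l <= k)%N -> (l <= l0)%N -> z l <= X) ->
  (forall l, (2 <= l <= k)%N -> (l0 < l)%N -> z l <= rho) ->
  \sum_(2 <= l < k.+1) overlap p m k l <= l0%:R * X ^+ 2 + k%:R * rho ^+ l0.
Proof.
move=> p01 /andP[k2 km] /andP[X0 X1] /andP[r0 r1] z zX zr.
have z0 l : 0 <= z l.
  by rewrite !mulr_ge0 ?invr_ge0 ?ler0n ?(ltW (exp_gt0 _)).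
(* Adding [rho ^ l0] to every term makes one bound valid on both ranges; at most [l0] terms carry
   the [X ^ 2]. *)
have bnd l : (2 <= l <= k)%N -> overlap p m k l <=
    (if (l <= l0)%N then X ^+ 2 else 0) + rho ^+ l0.
  move=> /andP[l2 lk]; apply: le_trans (overlap_le_exp p01 _ km) _.
    by rewrite lk (leq_trans _ l2).
  rewrite -/(z l); case: (leqP l l0) => ll.
    have h : z l ^+ l <= X ^+ 2.
      apply: le_trans (_ : X ^+ l <= _).
        by apply: lerXn2r; rewrite ?nnegrE // zX // l2.
      by apply: ler_wiXn2l.
    by apply: le_trans h _; rewrite lerDl exprn_ge0.
  rewrite add0r; apply: le_trans (_ : rho ^+ l <= _).
    by apply: lerXn2r; rewrite ?nnegrE // zr // l2.
  by apply: ler_wiXn2l => //; apply: ltnW.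
apply: le_trans (_ : \sum_(2 <= l < k.+1) ((if (l <= l0)%N then X ^+ 2 else 0) + rho ^+ l0) <= _).
  rewrite [leLHS]big_nat_cond [leRHS]big_nat_cond; apply: ler_sum => l.
  by rewrite andbT ltnS; apply: bnd.
rewrite big_split /=; apply: lerD; last first.
  rewrite sumr_const_nat -[leLHS]mulr_natl ler_wpM2r ?exprn_ge0 // ler_nat.
  by rewrite subSS leq_subr.
rewrite -big_mkcond /= big_const_seq iter_addr_0 -[leLHS]mulr_natl ler_wpM2r ?exprn_ge0 //.
rewrite ler_nat -size_filter.
have : uniq [seq l <- index_iota 2 k.+1 | (l <= l0)%N] by rewrite filter_uniq ?iota_uniq.
move/uniq_leq_size => /(_ (iota 1 l0)); rewrite size_iota; apply=> l.
rewrite mem_filter mem_index_iota mem_iota; lia.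
Qed.

Lemma prob_not_has_transversal_indep_le n (p : R) (k a m l0 : nat) (X rho : R) :
  0 <= p < 1 -> (2 <= k <= m)%N -> (2 * a * k ^ 2 < m)%N -> (2 <= n)%N ->
  0 < X <= 1 -> 0 <= rho <= 1 -> (0 < l0)%N ->
  let z l := exp 1 * k%:R / l%:R * (k%:R / m%:R) * exp (- ln (1 - p) / 2 * l%:R) in
  (forall l, (2 <= l <= k)%N -> (l <= l0)%N -> z l <= X) ->
  (forall l, (2 <= l <= k)%N -> (l0 < l)%N -> z l <= rho) ->
  Ex p (slots n) (fun E => (~~ has_transversal_indep k a m E)%:R) <=
  exp (2 * n%:R * ln n%:R - (8 * (l0%:R * X ^+ 2 + k%:R * rho ^+ l0))^-1).
Proof.
move=> p01 km akm n2 /andP[X0 X1] r01 l00 z zX zr.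
have n0 : 0 < n%:R :> R by rewrite ltr0n; lia.
apply: le_trans (prob_not_has_transversal_indep_exp n p01 km akm) _.
have -> : exp (2 * n%:R * ln n%:R - (8 * (l0%:R * X ^+ 2 + k%:R * rho ^+ l0))^-1) =
   n%:R ^+ (2 * n) * exp (- (8 * (l0%:R * X ^+ 2 + k%:R * rho ^+ l0))^-1).
  rewrite -[in RHS](exp_lnK n0) expr_exp_mul natrM; exact: exp_plus.
apply: ler_pM; rewrite ?ler0n ?(ltW (exp_gt0 _)) //.
  (* As [n >= 2], [n^n 2^n <= n^(2 n)]. *)
  by rewrite -natrX ler_nat mul2n -addnn expnD leq_mul // leq_exp2r //; lia.
apply: exp_monotone; rewrite lerN2.
have S0 : 0 < \sum_(2 <= l < k.+1) overlap p m k l.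
  have /andP[k2 mk] := km; have /andP[p0 p1] := p01.
  rewrite big_nat_recl // ltr_wpDr ?sumr_ge0 // => [l _|]; first exact: overlap_ge0.
  rewrite /overlap mulr_gt0 ?exprn_gt0 ?divr_gt0 ?exprn_gt0 ?ltr0n ?bin_gt0 ?invr_gt0 //.
    by lia.
  by lra.
rewrite lef_pV2 ?posrE ?pmulr_rgt0 //; last first.
  apply: lt_le_trans S0 _; apply: overlap_sum_le => //; by rewrite (ltW X0).
rewrite ler_pM2l //; apply: overlap_sum_le => //; by rewrite (ltW X0).
Qed.

Lemma prob_not_no_large_indep_le n (p : R) (a : nat) : 0 <= p < 1 -> (0 < a)%N ->
  let y := exp 1 * n%:R / a.+1%:R * exp (- (- ln (1 - p) / 2 * a%:R)) in
  y <= 1 ->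
  Ex p (slots n) (fun E => (~~ no_large_indep a E)%:R) <= y.
Proof.
move=> /andP[p0 p1] a0 y y1.
have p01 : 0 <= p <= 1 by lra.
have q0 : 0 < 1 - p by lra.
have y0 : 0 <= y by rewrite /y !mulr_ge0 ?invr_ge0 ?ler0n ?(ltW (exp_gt0 _)).
apply: le_trans (prob_not_no_large_indep n a p01) _.
pose c := exp (ln (1 - p) / 2).
have c2 : 1 - p = c ^+ 2.
  rewrite /c expr_exp_mul; have -> : 2%:R * (ln (1 - p) / 2) = ln (1 - p) by field.
  by rewrite exp_lnK.
(* The first moment is at most [y ^ (a + 1)]; since [y <= 1], it is enough to keep one factor. *)
apply: le_trans (_ : y ^+ a.+1 <= _); last by rewrite exprS ler_piMr // exprn_ile1 // y0.
rewrite c2 expr_bin2 /= /y [leRHS]exprMn.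
apply: ler_pM; rewrite ?ler0n ?exprn_ge0 ?(ltW (exp_gt0 _)) //; first exact: bin_le_exp.
rewrite /c expr_exp_mul; have -> : a%:R * (ln (1 - p) / 2) = - (- ln (1 - p) / 2 * a%:R) by field.
exact: lexx.
Qed.

Lemma prob_not_locally_sparse_le n (p : R) (m D : nat) : 0 <= p <= 1 ->
  Ex p (slots n) (fun E => (~~ locally_sparse m D E)%:R) <=
  exp (n%:R * exp (3 * p * m%:R - D%:R / 2)) - 1.
Proof.
move=> p01; apply: le_trans (prob_not_locally_sparse n m D p01) _.
rewrite lerD2r -expr_exp_mul.
have h0 : 0 <= (1 + 3 * p) ^+ m / 2 ^+ D.
  by rewrite divr_ge0 ?exprn_ge0 //; have := p01; lra.
apply: lerXn2r; rewrite ?nnegrE ?(ltW (exp_gt0 _)) ?addr_ge0 //.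
apply: le_trans (one_plus_le_exp _) _; apply: exp_monotone.
have e1 : (1 + 3 * p) ^+ m <= exp (3 * p * m%:R).
  rewrite [3 * p * _]mulrC -expr_exp_mul; apply: lerXn2r;
    rewrite ?nnegrE ?(ltW (exp_gt0 _)) ?one_plus_le_exp //.
  by have := p01; lra.
(* Equivalent to [1 / 2 <= exp (- 1 / 2)] raised to the power [D]. *)
have e2 : exp (D%:R / 2) <= 2 ^+ D.
  rewrite -expr_exp_mul; apply: lerXn2r; rewrite ?nnegrE ?(ltW (exp_gt0 _)) //.
  have h : 1 + - 2^-1 <= exp (- 2^-1) := one_plus_le_exp _.
  have e3 : exp (- 2^-1) = (exp (2^-1))^-1 by exact: exp_Ropp.
  rewrite e3 in h; have e0 := exp_gt0 (2^-1).
  have : 2^-1 * exp (2^-1) <= (exp (2^-1))^-1 * exp (2^-1).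
    by rewrite ler_pM2r //; lra.
  by rewrite mulVf ?gt_eqF //; lra.
have -> : exp (3 * p * m%:R - D%:R / 2) = exp (3 * p * m%:R) * exp (- (D%:R / 2))
  by exact: exp_plus.
have -> : exp (- (D%:R / 2)) = (exp (D%:R / 2))^-1 by exact: exp_Ropp.
apply: ler_pM => //; rewrite ?exprn_ge0 ?invr_ge0 ?exprn_ge0 //; first by have := p01; lra.
by rewrite lef_pV2 ?posrE ?exprn_gt0 ?exp_gt0.
Qed.

(** * Comparison of the two chromatic numbers *)

Lemma IZR_natr (z : positive) : IZR (Z.pos z) = (nat_of_pos z)%:R.
Proof. by rewrite IZRposE INRE. Qed.

Lemma overlap_baseE (p : R) (k m l : nat) :
  overlap_base p (INR k) (INR m) (INR l) =
  exp 1 * k%:R / l%:R * (k%:R / m%:R) * exp (- ln (1 - p) / 2 * l%:R).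
Proof. by rewrite /overlap_base !INRE !RdivE (IZR_natr 2). Qed.

(** Multiplied by [a], both [2 * chi] and [tau] lie between [2 n] and [(2 + delta) n]. They differ
    by at most [delta n], and [n <= a chi] makes the error relative. *)
Lemma tau_chi_close n (E : {set 'I_n * 'I_n}) (k a m D : nat) (delta : R) :
  edge_ok E -> (0 < k)%N -> (1 < a)%N -> 0 <= delta <= 1 ->
  2 * a%:R * (n%:R / k%:R + D%:R + a%:R + 1) <= (2 + delta) * n%:R ->
  has_transversal_indep k a m E -> no_large_indep a E -> locally_sparse m D E ->
  `|(tau 2 E)%:R - 2 * (chi E)%:R| <= delta * (chi E)%:R :> R.
Proof.
move=> ok k0 a1 d01 hK h1 h2 h3.
set K := (n %/ k + (D + a).+1)%N.
have kR : 0 < k%:R :> R by rewrite ltr0n.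
have aR : 2 <= a%:R :> R by rewrite ler_nat.
have nR : 0 <= n%:R :> R by rewrite ler0n.
have KR : K%:R <= n%:R / k%:R + D%:R + a%:R + 1 :> R.
  rewrite /K natrD -addn1 !natrD.
  have : (n %/ k)%N%:R <= n%:R / k%:R :> R by rewrite ler_pdivlMr // -natrM ler_nat leq_trunc_div.
  lra.
have aK : 2 * a%:R * K%:R <= (2 + delta) * n%:R :> R.
  by apply: le_trans hK; rewrite ler_wpM2l //; lra.
(* From [2 a K <= 3 n] and [a >= 2]. *)
have Kn : (K <= n)%N.
  rewrite -(ler_nat R); have : 0 <= K%:R :> R by rewrite ler0n.
  nra.
have a0 : (0 < a)%N by apply: ltnW.
have [c1 t1 c2 t2] := chi_tau_bounds ok k0 a0 h1 h2 h3 Kn.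
move: c1 t1 c2 t2; rewrite -/K -!(ler_nat R) !natrM => c1 t1 c2 t2.
have c0 : 0 <= (chi E)%:R :> R by rewrite ler0n.
have aP : 0 < a%:R :> R by lra.
have dP : 0 <= delta by case/andP: d01.
have ac := ler_wpM2l (ltW aP) c1; have at_ := ler_wpM2l (ltW aP) t1.
have dn := ler_wpM2l dP c2.
by rewrite ler_norml; apply/andP; split; rewrite -(ler_pM2l aP); lra.
Qed.

Delimit Scope R_scope with coqR.

(** Each of the three graph properties fails with probability at most [kappa]. The event [A] is
    arbitrary above the closeness event, so that a weaker [delta] can be used later. *)
Lemma tau_chi_whp (eps delta kappa : R) :
  (0 < eps < 1)%coqR -> (0 < delta <= 1)%coqR -> (0 < kappa <= 1)%coqR ->
  exists N : nat, forall n (p : R), (N <= n)%N ->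
  (Rpower (INR n) (-1/4) * Rpower (ln (INR n)) (9/4) <= p < eps)%coqR ->
  forall A : {set 'I_n * 'I_n} -> bool,
  (forall E, edge_ok E ->
     (Rabs (INR (tau 2 E) - 2 * INR (chi E)) <= delta * INR (chi E))%coqR -> A E) ->
  (1 - (kappa + kappa + kappa) <= gnp_prob p A <= 1)%coqR.
Proof.
move=> eps01 delta01 [k0' k1'].
have [N HN] := asymptotic_parameters _ _ _ eps01 delta01 k0'.
have e1 : eps < 1 by apply/RltP; case: eps01.
have d0 : 0 < delta by apply/RltP; case: delta01.
have d1 : delta <= 1 by apply/RleP; case: delta01.
have {k0'} k0 : 0 < kappa by apply/RltP.
have {k1'} k1 : kappa <= 1 by apply/RleP.
exists N => n p /ssrnat.leP Nn pe' A hA; have [/RleP pl /RltP pe] := pe'.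
have p0 : 0 < p by apply: lt_le_trans pl; apply: mulr_gt0; apply: exp_gt0.
have p01 : 0 <= p <= 1 by lra.
have p01' : 0 <= p < 1 by lra.
have [k [a [m [D [l0 [X [rho H]]]]]]] :=
  HN n p Nn (elimT RltP p0) pe'.
case: H => [[n2 [k3 [a100 [km [l00 akm]]]]] [hK [[[X0 X1] [[r0 r1] [zX zr]]] [b1 [b2 b3]]]]].
have {}n2 : (2 <= n)%N by rewrite -(ler_nat R) -!INRE; apply/RleP.
have {}k3 : (3 <= k)%N by rewrite -(ler_nat R) -!INRE; apply/RleP; move: k3 => /=; Lra.lra.
have {}a100 : (100 <= a)%N.
  rewrite -(ler_nat R) -[a%:R]INRE; apply/RleP; move: a100; rewrite (IZR_natr 100).
  by [].
have {}km : (k <= m)%N by rewrite -(ler_nat R) -!INRE; apply/RleP.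
have {}l00 : (0 < l0)%N by rewrite -(ltr_nat R) -!INRE; apply/RltP.
have {}akm : (2 * a * k ^ 2 < m)%N.
  rewrite -(ltr_nat R) natrM natrX natrM; apply/RltP.
  by move: akm; rewrite !INRE RpowE (IZR_natr 2).
suff /andP[/RleP low /RleP up] : 1 - (kappa + kappa + kappa) <= gnp_prob p A <= 1 by [].
apply: (@gnp_prob_bounds n p A (has_transversal_indep k a m) (no_large_indep a)
  (locally_sparse m D)) => //.
- move=> E ok h1 h2 h3; apply: hA => //.
  apply/RleP; rewrite !INRE RabsE (IZR_natr 2).
  apply: (tau_chi_close ok _ _ _ _ h1 h2 h3).
  + by apply: leq_trans k3.
  + by apply: leq_trans a100.
  + by rewrite (ltW d0).
  move/RleP: hK; rewrite !INRE (IZR_natr 2); exact.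
- move/RleP: b1; apply: le_trans.
  apply: le_trans (prob_not_has_transversal_indep_le (l0 := l0) (X := X) (rho := rho)
    p01' _ _ n2 _ _ l00 _ _) _ => //.
  + by rewrite km andbT ltnW.
  + by apply/andP; split; [apply/RltP|apply/RleP].
  + by apply/andP; split; apply/RleP.
  + move=> l /andP[l2 lk] ll; rewrite -overlap_baseE; apply/RleP.
    apply: zX; last by apply/RleP; rewrite !INRE ler_nat.
    by split; apply/RleP; rewrite ?INRE ?(IZR_natr 2) ler_nat.
  + move=> l /andP[l2 lk] ll; rewrite -overlap_baseE; apply/RleP.
    by apply: zr; split; apply/RleP; rewrite ?INRE ?(IZR_natr 2) ler_nat.
  + by rewrite !INRE !RpowE (IZR_natr 2) (IZR_natr 8).
- have y_le : exp 1 * n%:R / a.+1%:R * exp (- (- ln (1 - p) / 2 * a%:R)) <= kappa.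
    by move/RleP: b2; rewrite -S_INR !INRE (IZR_natr 2).
  apply: (le_trans _ y_le); apply: prob_not_no_large_indep_le => //; first by apply: leq_trans a100.
  exact: le_trans y_le k1.
- move/RleP: b3; apply: le_trans; apply: le_trans (prob_not_locally_sparse_le n m D p01) _.
  by rewrite !INRE (IZR_natr 2) (IZR_natr 3).
Qed.

Local Close Scope ring_scope.
Delimit Scope R_scope with R.

Theorem theorem1 :
  forall eps : R, (eps < 1)%R ->
  exists C0 : R, forall C : R, (C0 <= C)%R ->
  forall p : nat -> R,
    (exists N : nat, forall n : nat, (N <= n)%nat ->
       (C * Rpower (INR n) (-1/4) * Rpower (ln (INR n)) (9/4) <= p n)%R
       /\ (p n < eps)%R) ->
  forall delta : R, (0 < delta)%R ->
    Un_cv (fun n : nat =>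
             @gnp_prob n (p n)
               (fun E => Rleb
                  (Rabs (INR (tau 2 E) - 2 * INR (chi E)))
                  (delta * INR (chi E))))
          1%R.
Proof.
move=> eps eps1; exists 1%R => C C1 p [N1 HN1] delta d0 kappa' k'0.
have pow_pos n : (0 < Rpower (INR n) (-1/4) * Rpower (ln (INR n)) (9/4))%R.
  by apply: Rmult_lt_0_compat; apply: exp_pos.
have pl n : (N1 <= n)%nat ->
    (Rpower (INR n) (-1/4) * Rpower (ln (INR n)) (9/4) <= p n)%R.
  move=> /HN1[h _]; apply: Rle_trans h; rewrite Rmult_assoc.
  have := Rmult_le_compat_r _ _ _ (Rlt_le _ _ (pow_pos n)) C1.
  by rewrite Rmult_1_l.
(* Positivity of [eps] follows from [0 < p N1 < eps]. *)
have eps0 : (0 < eps)%R.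
  have [_ h] := HN1 N1 (leqnn _); have := pl N1 (leqnn _); have := pow_pos N1; Lra.lra.
(* Both truncations at [1] meet the ranges assumed in [tau_chi_whp]; the [4] keeps three errors
   [kappa] strictly below [kappa']. *)
pose dl := Rmin delta 1; pose kappa := Rmin (kappa' / 4) 1.
have dlP : (0 < dl <= 1)%R.
  by rewrite /dl; split; [apply: Rmin_glb_lt; Lra.lra|apply: Rmin_r].
have kaP : (0 < kappa <= 1)%R.
  by rewrite /kappa; split; [apply: Rmin_glb_lt; Lra.lra|apply: Rmin_r].
have [N2 HN2] := tau_chi_whp (conj eps0 eps1) dlP kaP.
exists (maxn N1 N2) => n /ssrnat.leP; rewrite geq_max => /andP[n1 n2].
set A := (fun E => _).
have [low up] : (1 - (kappa + kappa + kappa) <= gnp_prob (p n) A <= 1)%R.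
  apply: (HN2 n (p n) n2); first by split; [apply: pl|case: (HN1 n n1)].
  move=> E ok h; rewrite /A /Rleb; case: Rle_dec => // -[].
  apply: Rle_trans h _; apply: Rmult_le_compat_r; first exact: pos_INR.
  exact: Rmin_l.
have kk : (kappa <= kappa' / 4)%R by apply: Rmin_l.
by rewrite /Rdist; apply: Rabs_def1; Lra.lra.
Qed.
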